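(* Let $K,A,M,q$ be as in the context, with $\operatorname{Ann}_A M=\{a\in A: am=0\ \forall m\in M\}=0$, let $\mathcal E$ be a subalgebra of $\operatorname{osp}(q)$ containing $\operatorname{eosp}(q)$, and let $L=\mathcal E_\infty$, $\mathcal S=\mathcal S_{\mathcal E}$, $\mathcal T=\mathcal T_{\mathcal E}$ and $\mathcal D_M=\{d_{S,T}: S\in\mathcal S,\ T\in\mathcal T\}$ (all defined in the context). Then: 1) $\mathcal D_M=(\operatorname{Der}_K L)_0$, where $(\operatorname{Der}_K L)_0=\{d\in\operatorname{Der}_K L: d(L_\sigma)\subset L_\sigma,\ \sigma=0,\pm\}$. In particular, $\mathcal D_M$ is a subalgebra of $\operatorname{Der}_K L$, and the map $\phi:\mathcal S\oplus\mathcal T\to\mathcal D_M$, $S\oplus T\mapsto d_{S,T}$, is a Lie superalgebra isomorphism. 2) $\operatorname{Der}_K L=\operatorname{ad}L+\mathcal D_M$. 3) $\operatorname{ad}L\cap\mathcal D_M=\{d_{S,T}\in\mathcal D_M: S\in\mathcal E,\ T\in A\cdot\mathrm{Id}\}=\operatorname{ad}L_0$. 4) If $\mathcal S=\mathcal E\oplus\mathcal S_0$ and $\mathcal T=A\cdot\mathrm{Id}\oplus\mathcal T_0$, where $\mathcal S_0\oplus\mathcal T_0$ is a subalgebra of the Lie superalgebra $\mathcal S\oplus\mathcal T$, then $\operatorname{Der}_K L=\operatorname{ad}L\rtimes\mathcal D_{\mathcal S_0,\mathcal T_0}$, where $\mathcal D_{\mathcal S_0,\mathcal T_0}=\{d_{S,T}: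 S\in\mathcal S_0,\ T\in\mathcal T_0\}$.
   Context: Conventions. All structures are $\mathbb Z_2$-graded; $|z|$ is the degree of a homogeneous element $z$, and formulas involving $|z|$ are for homogeneous elements, extended linearly. Submodules and subalgebras are graded. $K$ is a unital associative superring containing $\tfrac12$ that is supercommutative: $ab=(-1)^{|a||b|}ba$. A $K$-supermodule is a $K$-bimodule $M=M_{\bar0}\oplus M_{\bar1}$ with $K_\alpha M_\beta\subset M_{\alpha+\beta}$ and $am=(-1)^{|a||m|}ma$. A map $\phi$ of supermodules is $K$-linear if it is additive and $\phi(ma)=\phi(m)a$; $\operatorname{End}_K M$ is the $K$-supermodule of $K$-linear maps $M\to M$ (graded by degree), with $(a\phi)(m)=a\phi(m)$, $(\phi a)(m)=\phi(am)$. Bilinear means biadditive with $\phi(ma,n)=\phi(m,an)$, $\phi(m,na)=\phi(m,n)a$. For endomorphisms, $[x,y]=xy-(-1)^{|x||y|}yx$. $A$ is a superextension of $K$, i.e. a unital associative supercommutative $K$-superalgebra. $M$ is an $A$-supermodule with an $A$-quadratic form $q$, i.e. an $A$-bilinear map $q:M\times M\to A$ of degree $\bar0$ with $q(m,n)=(-1)^{|m||n|}q(n,m)$. $a\cdot\mathrm{Id}$ denotes $m\mapsto am$. $\operatorname{osp}(q)=\{x\in\operatorname{End}_A M: q(x(m),n)+(-1)^{|m||n|}q(x(n),m)=0\ \forall m,n\in M\}$. $\mathbf E_{m,n}(p)=m\,q(n,p)-(-1)^{|n||p|}q(m,p)n$, and $\operatorname{eosp}(q)$ is the $\mathbb Z$-span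 of all $\mathbf E_{m,n}$. For a ($K$-)subalgebra $\mathcal E$ with $\operatorname{eosp}(q)\subset\mathcal E\subset\operatorname{osp}(q)$, $L=\mathcal E_\infty=\{(a,m,n,x): a\in A,\ m,n\in M,\ x\in\mathcal E\}$ is the Lie superalgebra over $K$ with product $[(a,m,n,x),(a',m',n',x')]=\big(q(m,n')-q(n,m'),\ am'+xm'-ma'-(-1)^{|x'||m|}x'm,\ -an'+xn'+na'-(-1)^{|x'||n|}x'n,\ \mathbf E_{m,n'}+\mathbf E_{n,m'}+[x,x']\big)$. Put $L_0=\{(a,0,0,x)\}$, $L_+=\{(0,m,0,0)\}$, $L_-=\{(0,0,n,0)\}$. $\operatorname{Der}_K L$: spanned by homogeneous $K$-linear $d$ with $d[x,y]=[d(x),y]+(-1)^{|d||x|}[x,d(y)]$. $\operatorname{ad}(x)(y)=[x,y]$; $\operatorname{ad}L=\{\operatorname{ad}(x):x\in L\}$. $X\rtimes Y$ means a direct sum of an ideal $X$ and a subalgebra $Y$. $\mathcal S_{\mathcal E}$ is the span of the homogeneous $S\in\operatorname{End}_K M$ with: (S1) $[S,A\cdot\mathrm{Id}]\subset A\cdot\mathrm{Id}$; (S2) $[S,q(m,n)\mathrm{Id}]=(q(S(m),n)+(-1)^{|m||n|}q(S(n),m))\mathrm{Id}$ for all homogeneous $m,n\in M$; (S3) $[S,\mathcal E]\subset\mathcal E$. $\mathcal T_{\mathcal E}$ is the span of the homogeneous $T\in\operatorname{End}_K M$ with: (T1) $[T,A\cdot\mathrm{Id}]\subset\mathcal E$;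 (T2) $[T,q(m,n)\mathrm{Id}]=\mathbf E_{T(m),n}+(-1)^{|m||n|}\mathbf E_{T(n),m}$ for all homogeneous $m,n$; (T3) $[T,\mathcal E]\subset A\cdot\mathrm{Id}$. $\mathcal S\oplus\mathcal T$ (external direct sum) is a Lie superalgebra with product $[S\oplus T,S'\oplus T']=([S,S']+[T,T'])\oplus([S,T']+[T,S'])$. For $S\in\mathcal S$, $T\in\mathcal T$, $d_{S,T}$ is the $K$-endomorphism of $L$ given by $d_{S,T}(a,m,n,x)=([S,a\,\mathrm{Id}]+[T,x],\ (S+T)(m),\ (S-T)(n),\ [T,a\,\mathrm{Id}]+[S,x])$, where $A$ is identified with $A\cdot\mathrm{Id}$ (possible since $\operatorname{Ann}_AM=0$). *)

(* Defs.v *)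
From HB Require Import structures.
From mathcomp Require Import all_boot all_algebra.
From mathcomp Require Import boolp classical_sets functions.

Set Implicit Arguments.
Unset Strict Implicit.
Unset Printing Implicit Defensive.

Import GRing.Theory.
Local Open Scope classical_set_scope.
Local Open Scope ring_scope.

(* A Z_2-grading is given by its projections [gr false] and [gr true] onto    *)
(* the even and the odd part; the degree |z| is a boolean, so that degrees    *)
(* are added with [addb] and (-1)^(|x||y|) is the sign [sg (|x| && |y|)].     *)
HB.mixin Record isGraded V of GRing.Zmodule V := {
  gr : bool -> V -> V;
  grD : forall i (u v : V), gr i (u + v) = gr i u + gr i v;
  gr_gr : forall i j (v : V), gr i (gr j v) = if i == j then gr j v else 0;
  gr_sum : forall v : V, gr false v + gr true v = v
}.
#[short(type="superZmodType")]
HB.structure Definition SuperZmod := {V of GRing.Zmodule V & isGraded V}.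

Definition hom (V : superZmodType) (i : bool) (v : V) : Prop := gr i v = v.

Definition sg (V : zmodType) (b : bool) (v : V) : V := if b then - v else v.

(* The biadditive extension of (u, v) |-> (-1)^(|u||v|) f(u, v).              *)
Definition koszul (U V : superZmodType) (W : zmodType) (f : U -> V -> W)
    (u : U) (v : V) : W :=
  \sum_(i : bool) \sum_(j : bool) sg (i && j) (f (gr i u) (gr j v)).

HB.mixin Record isSuperRing R of GRing.PzRing R & isGraded R := {
  grM : forall i j (x y : R), hom i x -> hom j y -> hom (i (+) j) (x * y);
  gr1 : hom false (1 : R)
}.
#[short(type="superRingType")]
HB.structure Definition SuperRing :=
  {R of GRing.PzRing R & isGraded R & isSuperRing R}.

HB.mixin Record isSuperCommutative R of SuperRing R := {
  scommM : forall i j (x y : R), hom i x -> hom j y ->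
    x * y = sg (i && j) (y * x)
}.
#[short(type="scRingType")]
HB.structure Definition ScRing := {R of SuperRing R & isSuperCommutative R}.

(* In a supermodule over a supercommutative superring the right action is     *)
(* determined by the left one and the sign rule, see [rscale] below; the      *)
(* bimodule axioms are then consequences.                                     *)
HB.mixin Record isSuperModule (K : scRingType) V
    of GRing.Lmodule K V & isGraded V := {
  grZ : forall i j (k : K) (v : V), hom i k -> hom j v -> hom (i (+) j) (k *: v)
}.
#[short(type="supermodType")]
HB.structure Definition SuperModule (K : scRingType) :=
  {V of GRing.Lmodule K V & isGraded V & isSuperModule K V}.

(* [kscale] makes A a unital associative K-superalgebra.  It is not declared  *)
(* as a [GRing.scale] on A: this would need an [lalgType], which excludes the *)
(* zero ring.  The supermodule A over K is [resK A^o], defined below.         *)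
HB.mixin Record isSuperExtension (K : scRingType) A of ScRing A := {
  kscale : K -> A -> A;
  kscaleA : forall k l (a : A), kscale k (kscale l a) = kscale (k * l) a;
  kscale1 : forall a : A, kscale 1 a = a;
  kscaleDr : forall k (a b : A), kscale k (a + b) = kscale k a + kscale k b;
  kscaleDl : forall k l (a : A), kscale (k + l) a = kscale k a + kscale l a;
  kscaleAl : forall k (a b : A), kscale k (a * b) = kscale k a * b;
  gr_kscale : forall i j (k : K) (a : A), hom i k -> hom j a ->
    hom (i (+) j) (kscale k a)
}.
#[short(type="superextType")]
HB.structure Definition SuperExtension (K : scRingType) :=
  {A of ScRing A & isSuperExtension K A}.

Arguments grM {s i j x y}.
Arguments scommM {s i j x y}.
Arguments grZ {K s i j k v}.
Arguments gr_kscale {K s i j k a}.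

Section GradedTheory.
Variable V : superZmodType.
Implicit Types u v : V.

Lemma gr0 i : gr i (0 : V) = 0.
Proof. by apply: (addIr (gr i 0)); rewrite -grD !add0r. Qed.

Lemma grN i v : gr i (- v) = - gr i v.
Proof. by apply: (addIr (gr i v)); rewrite -grD !addNr gr0. Qed.

Lemma hom_gr i v : hom i (gr i v).
Proof. by rewrite /hom gr_gr eqxx. Qed.

Lemma gr_hom i j v : hom j v -> gr i v = if i == j then v else 0.
Proof. by move=> <-; rewrite gr_gr. Qed.

Lemma hom0 i : hom i (0 : V).
Proof. exact: gr0. Qed.

Lemma homD i u v : hom i u -> hom i v -> hom i (u + v).
Proof. by rewrite /hom grD => -> ->. Qed.

Lemma homN i v : hom i v -> hom i (- v).
Proof. by rewrite /hom grN => ->. Qed.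

Lemma hom_sg b i v : hom i v -> hom i (sg b v).
Proof. by case: b => //=; apply: homN. Qed.

Lemma gr_sg b i v : gr i (sg b v) = sg b (gr i v).
Proof. by case: b => //=; rewrite grN. Qed.

Lemma hom_ind (P : V -> Prop) :
  (forall u v, P u -> P v -> P (u + v)) ->
  (forall i v, hom i v -> P v) -> forall v, P v.
Proof. by move=> PD Ph v; rewrite -(gr_sum v); apply: PD; apply/Ph/hom_gr. Qed.

End GradedTheory.

Lemma sg0 (V : zmodType) b : sg b (0 : V) = 0.
Proof. by case: b; rewrite /= ?oppr0. Qed.

Lemma sgD (V : zmodType) b (u v : V) : sg b (u + v) = sg b u + sg b v.
Proof. by case: b; rewrite /= ?opprD. Qed.

Lemma sgsg (V : zmodType) b c (v : V) : sg b (sg c v) = sg (b (+) c) v.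
Proof. by case: b; case: c; rewrite /= ?opprK. Qed.

Lemma sg_morph (U V : zmodType) (f : U -> V) b u :
  {morph f : x y / x + y} -> f (sg b u) = sg b (f u).
Proof.
move=> fD; have f0 : f 0 = 0 by apply: (addIr (f 0)); rewrite -fD !add0r.
by case: b => //=; apply: (addIr (f u)); rewrite -fD !addNr f0.
Qed.

Definition biadd (U V W : zmodType) (f : U -> V -> W) : Prop :=
  (forall v, {morph f^~ v : x y / x + y}) /\ (forall u, {morph f u : x y / x + y}).

Section Koszul.
Variables (U V : superZmodType) (W : zmodType) (f : U -> V -> W).
Hypothesis fD : biadd f.

Lemma biadd0l v : f 0 v = 0.
Proof. by apply: (addIr (f 0 v)); rewrite -fD.1 !add0r. Qed.

Lemma biadd0r u : f u 0 = 0.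
Proof. by apply: (addIr (f u 0)); rewrite -fD.2 !add0r. Qed.

Lemma koszulDl v : {morph (koszul f)^~ v : x y / x + y}.
Proof.
move=> x y; rewrite /koszul -big_split; apply: eq_bigr => i _.
by rewrite -big_split; apply: eq_bigr => j _; rewrite grD fD.1 sgD.
Qed.

Lemma koszulDr u : {morph koszul f u : x y / x + y}.
Proof.
move=> x y; rewrite /koszul -big_split; apply: eq_bigr => i _.
by rewrite -big_split; apply: eq_bigr => j _; rewrite grD fD.2 sgD.
Qed.

Lemma koszul_biadd : biadd (koszul f).
Proof. by split=> [v|u]; [apply: koszulDl|apply: koszulDr]. Qed.

Lemma koszulE i j u v : hom i u -> hom j v ->
  koszul f u v = sg (i && j) (f u v).
Proof.
move=> hu hv; rewrite /koszul (bigD1 i) //= [X in _ + X]big1 ?addr0; last first.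
  move=> i' /negPf ii; rewrite big1 // => j' _.
  by rewrite (gr_hom i' hu) ii biadd0l sg0.
rewrite (bigD1 j) //= big1 ?addr0 ?hu ?hv // => j' /negPf jj.
by rewrite (gr_hom j' hv) jj biadd0r sg0.
Qed.

End Koszul.

Definition rscale (K : scRingType) (V : supermodType K) (v : V) (k : K) : V :=
  koszul (fun (l : K) (w : V) => l *: w) k v.
Notation "v *r k" := (rscale v k) (at level 40, left associativity) : ring_scope.

Section SuperModuleTheory.
Variables (K : scRingType) (V : supermodType K).
Implicit Types (v w : V) (k l : K).

Lemma scale_biadd : biadd (fun k v => k *: v).
Proof. by split=> [v k l|k v w]; rewrite ?scalerDl ?scalerDr. Qed.

Lemma scale_sgr b k v : k *: sg b v = sg b (k *: v).
Proof. by case: b; rewrite //= scalerN. Qed.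

Lemma scale_sgl b k v : sg b k *: v = sg b (k *: v).
Proof. by case: b; rewrite //= scaleNr. Qed.

Lemma rscale_hom i j k v : hom i k -> hom j v -> v *r k = sg (i && j) (k *: v).
Proof. by move=> hk hv; rewrite /rscale (koszulE scale_biadd hk hv). Qed.

Lemma rscaleDl k : {morph (fun v => v *r k) : v w / v + w}.
Proof. by move=> v w; rewrite /rscale (koszulDr scale_biadd). Qed.

Lemma rscaleDr v : {morph (fun k => v *r k) : k l / k + l}.
Proof. by move=> k l; rewrite /rscale (koszulDl scale_biadd). Qed.

Lemma hom_rscale i j k v : hom i k -> hom j v -> hom (j (+) i) (v *r k).
Proof.
move=> hk hv; rewrite (rscale_hom hk hv).
by apply: hom_sg; rewrite addbC; apply: grZ.
Qed.

Lemma rscaleA v k l : (v *r k) *r l = v *r (k * l).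
Proof.
elim/hom_ind: v => [u v Pu Pv|iv v hv]; first by rewrite !rscaleDl Pu Pv.
elim/hom_ind: k => [k1 k2 P1 P2|ik k hk].
  by rewrite mulrDl !(rscaleDr, rscaleDl) P1 P2.
elim/hom_ind: l => [l1 l2 P1 P2|il l hl].
  by rewrite mulrDr !rscaleDr P1 P2.
rewrite (rscale_hom hl (hom_rscale hk hv)) (rscale_hom (grM hk hl) hv).
rewrite (rscale_hom hk hv) (scommM hk hl).
rewrite scale_sgl scale_sgr !sgsg scalerA.
by case: (iv); case: (ik); case: (il).
Qed.

Lemma rscale1 v : v *r 1 = v.
Proof.
elim/hom_ind: v => [u v Pu Pv|iv v hv]; first by rewrite !rscaleDl Pu Pv.
by rewrite (rscale_hom gr1 hv) scale1r.
Qed.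

Lemma scaler_rscale k v l : k *: (v *r l) = (k *: v) *r l.
Proof.
elim/hom_ind: v => [u v Pu Pv|iv v hv].
  by rewrite !(rscaleDl, scalerDr) Pu Pv.
elim/hom_ind: k => [k1 k2 P1 P2|ik k hk].
  by rewrite !(rscaleDl, scalerDl) P1 P2.
elim/hom_ind: l => [l1 l2 P1 P2|il l hl].
  by rewrite !(rscaleDr, scalerDr) P1 P2.
rewrite (rscale_hom hl (grZ hk hv)) (rscale_hom hl hv).
rewrite scale_sgr !scalerA (scommM hk hl) scale_sgl !sgsg.
by case: (iv); case: (ik); case: (il).
Qed.

Lemma gr_rscale i j v k : hom j k -> gr i (v *r k) = gr (i (+) j) v *r k.
Proof.
move=> hk; elim/hom_ind: v => [u v Pu Pv|iv v hv].
  by rewrite !(rscaleDl, grD) Pu Pv.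
rewrite (gr_hom _ (hom_rscale hk hv)) (gr_hom _ hv).
have -> : (i == iv (+) j) = (i (+) j == iv) by case: (i) (iv) (j) => [] [] [].
case: ifP => // _; rewrite (rscale_hom hk (hom0 _ iv)) scaler0 sg0 //.
Qed.

Lemma gr_scale i j v k : hom j k -> gr i (k *: v) = k *: gr (i (+) j) v.
Proof.
move=> hk; elim/hom_ind: v => [u v Pu Pv|iv v hv].
  by rewrite !(scalerDr, grD) Pu Pv.
rewrite (gr_hom _ (grZ hk hv)) (gr_hom _ hv).
have -> : (i == j (+) iv) = (i (+) j == iv) by case: (i) (iv) (j) => [] [] [].
by case: ifP => // _; rewrite scaler0.
Qed.

End SuperModuleTheory.

#[local] Obligation Tactic := idtac.

Section Endomorphisms.
Variables (K : scRingType) (V : supermodType K).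

Record Endo := MkEndo {
  efun :> V -> V;
  EndoD : {morph efun : u v / u + v};
  EndoZ : forall v (k : K), efun (v *r k) = efun v *r k
}.

Lemma Endo_eq (f g : Endo) : (forall v, f v = g v) -> f = g.
Proof.
case: f g => [f fD fZ] [g gD gZ] /= fg.
have e : f = g by apply: funext.
by case: _ / e in gD gZ *; congr MkEndo; apply: Prop_irrelevance.
Qed.

HB.instance Definition _ := gen_eqMixin Endo.
HB.instance Definition _ := gen_choiceMixin Endo.

Lemma Endo0 (f : Endo) : f 0 = 0.
Proof. by apply: (addIr (f 0)); rewrite -EndoD !add0r. Qed.

Lemma EndoN (f : Endo) v : f (- v) = - f v.
Proof. by apply: (addIr (f v)); rewrite -EndoD !addNr Endo0. Qed.

Lemma rscale0 (k : K) : (0 : V) *r k = 0.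
Proof. by apply: (addIr (0 *r k)); rewrite -rscaleDl !add0r. Qed.

Lemma rscaleN (v : V) (k : K) : (- v) *r k = - (v *r k).
Proof. by apply: (addIr (v *r k)); rewrite -rscaleDl !addNr rscale0. Qed.

Program Definition Endo_zero := @MkEndo (fun=> 0) _ _.
Next Obligation. by move=> u v /=; rewrite addr0. Qed.
Next Obligation. by move=> v k /=; rewrite /= rscale0. Qed.

Program Definition Endo_add (f g : Endo) := @MkEndo (fun v => f v + g v) _ _.
Next Obligation. by move=> f g u v /=; rewrite !EndoD addrACA. Qed.
Next Obligation. by move=> f g v k /=; rewrite !EndoZ rscaleDl. Qed.

Program Definition Endo_opp (f : Endo) := @MkEndo (fun v => - f v) _ _.
Next Obligation. by move=> f u v /=; rewrite EndoD opprD. Qed.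
Next Obligation. by move=> f v k /=; rewrite EndoZ rscaleN. Qed.

Program Definition Endo_scale (k : K) (f : Endo) :=
  @MkEndo (fun v => k *: f v) _ _.
Next Obligation. by move=> k f u v /=; rewrite EndoD scalerDr. Qed.
Next Obligation. by move=> k f v l /=; rewrite EndoZ scaler_rscale. Qed.

Program Definition Endo_comp (f g : Endo) := @MkEndo (fun v => f (g v)) _ _.
Next Obligation. by move=> f g u v /=; rewrite !EndoD. Qed.
Next Obligation. by move=> f g v k /=; rewrite !EndoZ. Qed.

Program Definition Endo_gr (i : bool) (f : Endo) :=
  @MkEndo (fun v => \sum_(j : bool) gr (i (+) j) (f (gr j v))) _ _.
Next Obligation.
by move=> i f u v; rewrite -big_split; apply: eq_bigr => j _; rewrite grD EndoD grD.
Qed.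
Next Obligation.
move=> i f v k; elim/hom_ind: k => [k1 k2 P1 P2|il l hl].
  move: P1 P2; rewrite /= !big_bool /= => P1 P2.
  rewrite [RHS]rscaleDr -P1 -P2 !(rscaleDr v k1 k2) !(grD, EndoD).
  exact: addrACA.
rewrite /= !big_bool !(gr_rscale _ _ hl) !EndoZ !(gr_rscale _ _ hl) /= rscaleDl.
by case: (il) => /=; [rewrite !addbT negbK addbF addrC|rewrite !addbF].
Qed.

Lemma Endo_addA : associative Endo_add.
Proof. by move=> f g h; apply: Endo_eq => v; apply: addrA. Qed.
Lemma Endo_addC : commutative Endo_add.
Proof. by move=> f g; apply: Endo_eq => v; apply: addrC. Qed.
Lemma Endo_add0 : left_id Endo_zero Endo_add.
Proof. by move=> f; apply: Endo_eq => v; apply: add0r. Qed.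
Lemma Endo_addN : left_inverse Endo_zero Endo_opp Endo_add.
Proof. by move=> f; apply: Endo_eq => v; apply: addNr. Qed.
HB.instance Definition _ :=
  GRing.isZmodule.Build Endo Endo_addA Endo_addC Endo_add0 Endo_addN.

Lemma Endo_scaleA k l f : Endo_scale k (Endo_scale l f) = Endo_scale (k * l) f.
Proof. by apply: Endo_eq => v; apply: scalerA. Qed.
Lemma Endo_scale1 : left_id 1 Endo_scale.
Proof. by move=> f; apply: Endo_eq => v; apply: scale1r. Qed.
Lemma Endo_scaleDr : right_distributive Endo_scale +%R.
Proof. by move=> k f g; apply: Endo_eq => v; apply: scalerDr. Qed.
Lemma Endo_scaleDl f : {morph Endo_scale^~ f : k l / k + l}.
Proof. by move=> k l; apply: Endo_eq => v; apply: scalerDl. Qed.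
HB.instance Definition _ := GRing.Zmodule_isLmodule.Build K Endo
  Endo_scaleA Endo_scale1 Endo_scaleDr Endo_scaleDl.

Lemma Endo_grD i (f g : Endo) : Endo_gr i (f + g) = Endo_gr i f + Endo_gr i g.
Proof.
apply: Endo_eq => v /=; rewrite -big_split; apply: eq_bigr => j _; exact: grD.
Qed.
Lemma Endo_gr_gr i j f :
  Endo_gr i (Endo_gr j f) = if i == j then Endo_gr j f else 0.
Proof.
apply: Endo_eq => v /=; rewrite !big_bool /=.
by case: (i); case: (j); rewrite /= ?big_bool /=;
  do 4 rewrite ?(gr_gr, grD, gr0, Endo0, addr0, add0r) /=.
Qed.
Lemma Endo_gr_sum f : Endo_gr false f + Endo_gr true f = f.
Proof.
apply: Endo_eq => v; rewrite /= !big_bool /= addrACA.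
rewrite [gr true (f (gr true v)) + _]addrC !gr_sum addrC -EndoD.
by rewrite gr_sum.
Qed.
HB.instance Definition _ :=
  isGraded.Build Endo Endo_grD Endo_gr_gr Endo_gr_sum.

Lemma Endo_homP i (f : Endo) :
  hom i f <-> forall j v, hom j v -> hom (i (+) j) (f v).
Proof.
split=> [hf j v hv|hf].
  rewrite -hf /= (bigD1 j) //= big1 ?addr0 ?hv; first exact: hom_gr.
  by move=> j' /negPf jj; rewrite (gr_hom _ hv) jj Endo0 gr0.
apply: Endo_eq => v; rewrite /= big_bool /= -[in RHS](gr_sum v) EndoD addrC.
by congr (_ + _); apply: hf; apply: hom_gr.
Qed.

Lemma Endo_grZ i j k (f : Endo) : hom i k -> hom j f -> hom (i (+) j) (k *: f).
Proof.
move=> hk /Endo_homP hf; apply/Endo_homP => l v hv.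
by rewrite -addbA; apply: grZ => //; apply: hf.
Qed.
HB.instance Definition _ := isSuperModule.Build K Endo Endo_grZ.

Lemma Endo_addE (f g : Endo) v : (f + g) v = f v + g v. Proof. by []. Qed.
Lemma Endo_oppE (f : Endo) v : (- f) v = - f v. Proof. by []. Qed.
Lemma Endo_scaleE k (f : Endo) v : (k *: f) v = k *: f v. Proof. by []. Qed.
Lemma Endo_0E v : (0 : Endo) v = 0. Proof. by []. Qed.

Lemma Endo_sgE b (f : Endo) v : sg b f v = sg b (f v).
Proof. by case: b. Qed.

(* The right action on End_K V is (f k)(v) = f(k v).                          *)
Lemma Endo_rscaleE (f : Endo) k v : (f *r k) v = f (k *: v).
Proof.
elim/hom_ind: f => [f g Pf Pg|jf f hf]; first by rewrite rscaleDl !Endo_addE Pf Pg.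
elim/hom_ind: k => [k1 k2 P1 P2|ik k hk].
  by rewrite rscaleDr scalerDl EndoD !Endo_addE P1 P2.
elim/hom_ind: v => [u v Pu Pv|jv v hv].
  by rewrite scalerDr !EndoD Pu Pv.
rewrite (rscale_hom hk hf) Endo_sgE Endo_scaleE.
have := EndoZ f v k; rewrite (rscale_hom hk hv).
rewrite (rscale_hom hk ((Endo_homP _ _).1 hf _ _ hv)).
rewrite (sg_morph (f := f)); last exact: EndoD.
move=> /(congr1 (sg (ik && jv))); rewrite !sgsg addbb /= => ->.
by case: (ik); case: (jv); case: (jf).
Qed.

(* x y - (-1)^(|x||y|) y x, extended linearly.                                *)
Definition scomm (x y : Endo) : Endo :=
  Endo_comp x y - koszul (fun x' y' => Endo_comp y' x') x y.

Lemma Endo_scale_hom i j (x : Endo) (k : K) v : hom i x -> hom j k ->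
  x (k *: v) = sg (i && j) (k *: x v).
Proof.
by move=> hx hk; rewrite -Endo_rscaleE (rscale_hom hk hx) Endo_sgE andbC.
Qed.

Lemma Endo_compD : biadd (fun x y => Endo_comp x y).
Proof.
by split=> [y x x'|x y y']; apply: Endo_eq => v; rewrite //= EndoD.
Qed.

Lemma Endo_comprD : biadd (fun x y => Endo_comp y x).
Proof. by split=> [y x x'|x y y']; rewrite ?Endo_compD.1 ?Endo_compD.2. Qed.

Lemma scomm_biadd : biadd scomm.
Proof.
have [kl kr] := koszul_biadd Endo_comprD.
split=> [y x x'|x y y']; rewrite /scomm ?kl ?kr ?Endo_compD.1 ?Endo_compD.2;
  by rewrite opprD addrACA.
Qed.

Lemma scomm_hom i j x y : hom i x -> hom j y ->
  scomm x y = Endo_comp x y - sg (i && j) (Endo_comp y x).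
Proof. by move=> hx hy; rewrite /scomm (koszulE Endo_comprD hx hy). Qed.

Lemma Endo_grr i j (k : K) (x : Endo) : hom j k -> hom i x ->
  hom (i (+) j) (x *r k).
Proof. exact: hom_rscale. Qed.

Lemma scomm_rscale x y (k : K) : scomm x (y *r k) = scomm x y *r k.
Proof.
have [sl sr] := scomm_biadd.
elim/hom_ind: x => [x x' Px Px'|i x hx]; first by rewrite !sl rscaleDl Px Px'.
elim/hom_ind: y => [y y' Py Py'|j y hy].
  by rewrite rscaleDl !sr rscaleDl Py Py'.
elim/hom_ind: k => [k k' Pk Pk'|l k hk]; first by rewrite !rscaleDr sr Pk Pk'.
rewrite (scomm_hom hx (hom_rscale hk hy)) (scomm_hom hx hy).
apply: Endo_eq => v; rewrite Endo_rscaleE !Endo_addE !Endo_oppE !Endo_sgE /=.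
rewrite !Endo_rscaleE (Endo_scale_hom _ hx hk).
rewrite (sg_morph (f := y)) ?sgsg; last exact: EndoD.
by congr (_ - sg _ _); case: (i); case: (j); case: (l).
Qed.

Lemma scomm_scale x y (k : K) : scomm (k *: x) y = k *: scomm x y.
Proof.
have [sl sr] := scomm_biadd.
elim/hom_ind: x => [x x' Px Px'|i x hx].
  by rewrite scalerDr !sl scalerDr Px Px'.
elim/hom_ind: y => [y y' Py Py'|j y hy].
  by rewrite !sr scalerDr Py Py'.
elim/hom_ind: k => [k k' Pk Pk'|l k hk]; first by rewrite !scalerDl sl Pk Pk'.
rewrite (scomm_hom (grZ hk hx) hy) (scomm_hom hx hy) scalerBr scale_sgr.
apply: Endo_eq => v; rewrite !Endo_addE !Endo_oppE !Endo_sgE /=.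
rewrite (Endo_scale_hom _ hy hk) sgsg.
by congr (_ - sg _ _); case: (i); case: (j); case: (l).
Qed.

End Endomorphisms.

Section Submodules.
Variables (K : scRingType) (V : supermodType K).

Definition is_submod (N : set V) : Prop :=
  [/\ N 0, forall u v, N u -> N v -> N (u + v) & forall (k : K) v, N v -> N (k *: v)].

Definition is_gsubmod (N : set V) : Prop :=
  is_submod N /\ forall i v, N v -> N (gr i v).

Definition kspan (P : set V) : set V :=
  [set v | forall N, is_submod N -> P `<=` N -> N v].

Definition zspan (P : set V) : set V :=
  [set v | forall N : set V, N 0 -> (forall u w, N u -> N w -> N (u - w)) ->
     P `<=` N -> N v].

Definition setsum (X Y : set V) : set V :=
  [set v | exists x y, [/\ X x, Y y & v = x + y]].

Definition is_dsum (U X Y : set V) : Prop :=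
  [/\ is_gsubmod X, is_gsubmod Y, U = setsum X Y & X `&` Y = [set 0]].

Definition is_subalg (br : V -> V -> V) (U X : set V) : Prop :=
  [/\ X `<=` U, is_gsubmod X & forall x y, X x -> X y -> X (br x y)].

Definition is_ideal (br : V -> V -> V) (U X : set V) : Prop :=
  [/\ X `<=` U, is_gsubmod X &
      forall u x, U u -> X x -> X (br u x) /\ X (br x u)].

Definition is_semidirect (br : V -> V -> V) (U X Y : set V) : Prop :=
  [/\ is_ideal br U X, is_subalg br U Y & is_dsum U X Y].

End Submodules.

Section Derivations.
Variables (K : scRingType) (V : supermodType K).

Definition hom_der (br : V -> V -> V) (d : Endo V) : Prop :=
  exists2 i, hom i d & forall j x y, hom j x ->
    d (br x y) = br (d x) y + sg (i && j) (br x (d y)).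

Definition Der (br : V -> V -> V) : set (Endo V) := kspan (hom_der br).

End Derivations.

(* phi restricts to an isomorphism from the subalgebra X of (V, brV) onto the *)
(* subalgebra Y of (W, brW).                                                  *)
Definition is_lie_iso (K : scRingType) (V W : supermodType K)
    (brV : V -> V -> V) (brW : W -> W -> W)
    (X : set V) (Y : set W) (phi : V -> W) : Prop :=
  [/\ is_subalg brV setT X, is_subalg brW setT Y, set_bij X Y phi
    & [/\ forall u v, X u -> X v -> phi (u + v) = phi u + phi v,
       forall v (k : K), X v -> phi (v *r k) = phi v *r k,
       forall i v, X v -> hom i v -> hom i (phi v)
     & forall u v, X u -> X v -> phi (brV u v) = brW (phi u) (phi v)]].

Definition resK (K : scRingType) (A : superextType K) (M : supermodType A) : Type :=
  M.

Section Restriction.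
Variables (K : scRingType) (A : superextType K) (M : supermodType A).

HB.instance Definition _ := SuperZmod.on (resK M).

Let scl (k : K) (m : resK M) : resK M := kscale k (1 : A) *: (m : M).

Lemma kscale_mul k l : kscale (k * l) (1 : A) = kscale k 1 * kscale l 1.
Proof. by rewrite -kscaleAl mul1r kscaleA. Qed.

Lemma resK_scaleA k l m : scl k (scl l m) = scl (k * l) m.
Proof. by rewrite /scl scalerA -kscale_mul. Qed.
Lemma resK_scale1 : left_id 1 scl.
Proof. by move=> m; rewrite /scl kscale1 scale1r. Qed.
Lemma resK_scaleDr : right_distributive scl +%R.
Proof. by move=> k m n; rewrite /scl scalerDr. Qed.
Lemma resK_scaleDl m : {morph scl^~ m : k l / k + l}.
Proof. by move=> k l; rewrite /scl kscaleDl scalerDl. Qed.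
HB.instance Definition _ := GRing.Zmodule_isLmodule.Build K (resK M)
  resK_scaleA resK_scale1 resK_scaleDr resK_scaleDl.

Lemma hom_unit i (k : K) : hom i k -> hom i (kscale k (1 : A)).
Proof. by move=> hk; rewrite -[i]addbF; apply: (gr_kscale hk gr1). Qed.

Lemma resK_grZ i j k (m : resK M) :
  hom i k -> hom j m -> hom (i (+) j) (k *: m).
Proof. by move=> hk hm; apply: (@grZ A M) hm; apply: hom_unit. Qed.
HB.instance Definition _ := isSuperModule.Build K (resK M) resK_grZ.

Lemma resK_scaleE (k : K) (m : M) : k *: (m : resK M) = kscale k (1 : A) *: m.
Proof. by []. Qed.

Lemma resK_rscaleE (k : K) (m : M) :
  (m : resK M) *r k = m *r kscale k (1 : A).
Proof.
elim/hom_ind: m => [m n Pm Pn|j m hm]; first by rewrite !rscaleDl Pm Pn.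
elim/hom_ind: k => [k l Pk Pl|i k hk]; first by rewrite kscaleDl !rscaleDr Pk Pl.
by rewrite (rscale_hom (hom_unit hk) hm) (@rscale_hom K (resK M) i j).
Qed.

End Restriction.

Section Regular.
Variable A : scRingType.
HB.instance Definition _ := SuperZmod.copy A^o A.
Lemma regular_grZ i j (a : A) (b : A^o) :
  hom i a -> hom j b -> hom (i (+) j) (a *: b).
Proof. exact: grM. Qed.
HB.instance Definition _ := isSuperModule.Build A A^o regular_grZ.

Lemma regular_rscale (b : A^o) (a : A) : b *r a = (b : A) * a.
Proof.
elim/hom_ind: b => [b b' Pb Pb'|i b hb]; first by rewrite rscaleDl mulrDl Pb Pb'.
elim/hom_ind: a => [a a' Pa Pa'|j a ha]; first by rewrite rscaleDr mulrDr Pa Pa'.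
by rewrite (rscale_hom ha hb) (scommM (hb : @hom A i b) ha) andbC.
Qed.
End Regular.

Section Product.
Variables U V : superZmodType.
Definition prod_gr i (w : U * V) : U * V := (gr i w.1, gr i w.2).
Lemma prod_grD i u v : prod_gr i (u + v) = prod_gr i u + prod_gr i v.
Proof. by rewrite /prod_gr /= !grD. Qed.
Lemma prod_gr_gr i j v :
  prod_gr i (prod_gr j v) = if i == j then prod_gr j v else 0.
Proof. by rewrite /prod_gr /= !gr_gr; case: ifP. Qed.
Lemma prod_gr_sum v : prod_gr false v + prod_gr true v = v.
Proof. by case: v => a b; congr pair; apply: gr_sum. Qed.
HB.instance Definition _ :=
  isGraded.Build (U * V)%type prod_grD prod_gr_gr prod_gr_sum.
End Product.

Section ProductModule.
Variables (K : scRingType) (U V : supermodType K).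
Lemma prod_homE i (u : U) (v : V) : hom i (u, v) <-> hom i u /\ hom i v.
Proof. by split=> [[hu hv]|[hu hv]] //; congr pair. Qed.
Lemma prod_grZ i j (k : K) (v : U * V) :
  hom i k -> hom j v -> hom (i (+) j) (k *: v).
Proof.
case: v => a b hk /prod_homE[ha hb].
by apply/prod_homE; split; apply: grZ.
Qed.
HB.instance Definition _ := isSuperModule.Build K (U * V)%type prod_grZ.

Lemma prod_rscale (w : U * V) (k : K) : w *r k = (w.1 *r k, w.2 *r k).
Proof.
elim/hom_ind: w => [[a b] [a' b'] Pw Pw'|i [a b] hw].
  by rewrite rscaleDl Pw Pw' /= !rscaleDl.
elim/hom_ind: k => [k k' Pk Pk'|j k hk]; first by rewrite !rscaleDr Pk Pk'.
have /prod_homE[ha hb] := hw.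
rewrite (rscale_hom hk hw) (rscale_hom hk ha) (rscale_hom hk hb).
by case: (j && i).
Qed.
End ProductModule.

Section QuadraticForms.
Variables (K : scRingType) (A : superextType K) (M : supermodType A).

Record quadform := QuadForm {
  qf :> M -> M -> A;
  qf_biadd : biadd qf;
  qf_mid : forall (m n : M) (a : A), qf (m *r a) n = qf m (a *: n);
  qf_right : forall (m n : M) (a : A), qf m (n *r a) = qf m n * a;
  qf_even : forall i j (m n : M), hom i m -> hom j n -> hom (i (+) j) (qf m n);
  qf_sym : forall i j (m n : M), hom i m -> hom j n ->
    qf m n = sg (i && j) (qf n m)
}.

Definition EndoA : set (Endo (resK M)) :=
  [set x | forall (m : M) (a : A), x (m *r a) = (x m : M) *r a].

Lemma aId_additive (a : A) : {morph (fun m : resK M => a *: (m : M) : resK M) : m n / m + n}.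
Proof. by move=> m n; exact: (@scalerDr A M a m n). Qed.
Lemma aId_linear (a : A) (m : resK M) (k : K) :
  (a *: (m *r k : M) : resK M) = (a *: (m : M) : resK M) *r k.
Proof. by rewrite !resK_rscaleE scaler_rscale. Qed.
Definition aId (a : A) : Endo (resK M) := MkEndo (aId_additive a) (@aId_linear a).

Variable q : quadform.

Definition osp : set (Endo (resK M)) :=
  [set x | EndoA x /\ forall i j (m n : M), hom i m -> hom j n ->
     q (x m) n + sg (i && j) (q (x n) m) = 0].

(* [qscale m n p] is (-1)^(|n||p|) q(m, p) n, extended linearly.              *)
Let qscale (m n p : M) : M := koszul (fun n' p' : M => q m p' *: n') n p.

Let EE (m n p : M) : M := m *r q n p - qscale m n p.

Lemma qscale_biadd0 m : biadd (fun n p : M => q m p *: n).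
Proof.
split=> [p n n'|n p p']; first by rewrite scalerDr.
by rewrite (qf_biadd q).2 scalerDl.
Qed.

Lemma qscale_biadd m : biadd (qscale m).
Proof. exact/koszul_biadd/qscale_biadd0. Qed.

Lemma qscale_rscale m n p a : qscale m n (p *r a) = qscale m n p *r a.
Proof.
have [qDl qDr] := qscale_biadd m.
elim/hom_ind: n => [n n' Pn Pn'|i n hn]; first by rewrite !qDl rscaleDl Pn Pn'.
elim/hom_ind: p => [p p' Pp Pp'|j p hp].
  by rewrite rscaleDl !qDr rscaleDl Pp Pp'.
elim/hom_ind: a => [a a' Pa Pa'|k a ha].
  by rewrite !rscaleDr !qDr Pa Pa'.
rewrite /qscale (koszulE (qscale_biadd0 m) hn (hom_rscale ha hp)).
rewrite (koszulE (qscale_biadd0 m) hn hp) qf_right.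
rewrite (sg_morph (f := fun v => v *r a)); last exact: rscaleDl.
rewrite -scaler_rscale (rscale_hom ha hn) scale_sgr scalerA sgsg.
by case: (i); case: (j); case: (k).
Qed.

Lemma qscale_mid m n a p : qscale m (n *r a) p = qscale m n (a *: p).
Proof.
have [qDl qDr] := qscale_biadd m.
elim/hom_ind: n => [n n' Pn Pn'|i n hn]; first by rewrite !(rscaleDl, qDl) Pn Pn'.
elim/hom_ind: p => [p p' Pp Pp'|j p hp].
  by rewrite scalerDr !qDr Pp Pp'.
elim/hom_ind: a => [a a' Pa Pa'|k a ha].
  by rewrite rscaleDr scalerDl qDl qDr Pa Pa'.
rewrite /qscale (koszulE (qscale_biadd0 m) (hom_rscale ha hn) hp).
rewrite (koszulE (qscale_biadd0 m) hn (grZ ha hp)).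
have -> : a *: p = sg (j && k) (p *r a).
  by rewrite (rscale_hom ha hp) sgsg andbC addbb.
rewrite (sg_morph (f := q m)); last exact: (qf_biadd q).2.
rewrite qf_right scale_sgl -scalerA (rscale_hom ha hn) scale_sgr !sgsg.
by case: (i); case: (j); case: (k).
Qed.

Lemma EE_mid m n a p : EE m (n *r a) p = EE m n (a *: p).
Proof. by rewrite /EE qf_mid qscale_mid. Qed.

Lemma EE_biadd p : biadd (fun m n => EE m n p).
Proof.
split=> [n m m'|m n n'].
  rewrite /EE rscaleDl addrACA -opprD; congr (_ - _).
  rewrite /qscale /koszul -big_split; apply: eq_bigr => i _.
  rewrite -big_split; apply: eq_bigr => j _.
  by rewrite (qf_biadd q).1 scalerDl sgD.
rewrite /EE (qf_biadd q).1 rscaleDr (qscale_biadd m).1 opprD.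
by rewrite addrACA.
Qed.

Lemma EE_additive m n :
  {morph (EE m n : resK M -> resK M) : p p' / p + p'}.
Proof.
move=> p p'; rewrite /EE (qf_biadd q).2 rscaleDr (qscale_biadd m).2.
by rewrite opprD; apply: addrACA.
Qed.

Lemma EE_rscale m n (p : M) (a : A) : EE m n (p *r a) = EE m n p *r a.
Proof. by rewrite /EE qf_right -rscaleA qscale_rscale rscaleDl rscaleN. Qed.

Lemma EE_linear m n (p : resK M) (k : K) :
  EE m n (p *r k) = (EE m n p : resK M) *r k.
Proof. by rewrite !resK_rscaleE EE_rscale. Qed.

Definition Emn (m n : M) : Endo (resK M) :=
  MkEndo (EE_additive m n) (@EE_linear m n).

Lemma Emn_biadd : biadd Emn.
Proof.
by split=> [n m m'|m n n']; apply: Endo_eq => p;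
  [apply: (EE_biadd p).1|apply: (EE_biadd p).2].
Qed.

Lemma Emn_rscale m (n : resK M) (k : K) : Emn m (n *r k) = Emn m n *r k.
Proof.
apply: Endo_eq => p; rewrite Endo_rscaleE /= resK_rscaleE EE_mid.
by rewrite resK_scaleE.
Qed.

Definition eosp : set (Endo (resK M)) :=
  zspan [set x | exists m n, x = Emn m n].

Record ospSubalg := OspSubalg {
  ospS :> set (Endo (resK M));
  ospS_subalg : is_subalg (@scomm K (resK M)) osp ospS;
  ospS_eosp : eosp `<=` ospS
}.

End QuadraticForms.

Arguments Emn {K A M} q m n.
Arguments osp {K A M} q.
Arguments eosp {K A M} q.

Section OspSubalgType.
Variables (K : scRingType) (A : superextType K) (M : supermodType A).
Variables (q : quadform M) (E : ospSubalg q).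

Definition ospS_pred : {pred Endo (resK M)} := fun x => `[< ospS E x >].

Lemma ospS_submod : is_gsubmod E. Proof. by case: (ospS_subalg E). Qed.

Lemma ospS_submod_closed : GRing.submod_closed ospS_pred.
Proof.
have [[E0 ED EZ] _] := ospS_submod; split; first exact/asboolP.
by move=> k x y /asboolP Ex /asboolP Ey; apply/asboolP/ED => //; apply: EZ.
Qed.
HB.instance Definition _ := GRing.isSubmodClosed.Build K (Endo (resK M))
  ospS_pred ospS_submod_closed.

Record ospS_type := OspS { ospS_val :> Endo (resK M); _ : ospS_val \in ospS_pred }.
HB.instance Definition _ := [isSub for ospS_val].
HB.instance Definition _ := [Choice of ospS_type by <:].
HB.instance Definition _ := [SubChoice_isSubLmodule of ospS_type by <:].

Definition toE (x : Endo (resK M)) (Ex : ospS E x) : ospS_type := OspS (asboolT Ex).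

Lemma ospS_valP (x : ospS_type) : ospS E x.
Proof. by case: x => x /= /asboolP. Qed.

Definition ospS_gr i (x : ospS_type) : ospS_type :=
  toE (ospS_submod.2 i x (ospS_valP x)).
Lemma ospS_grD i x y : ospS_gr i (x + y) = ospS_gr i x + ospS_gr i y.
Proof. by apply: val_inj; apply: grD. Qed.
Lemma ospS_gr_gr i j x :
  ospS_gr i (ospS_gr j x) = if i == j then ospS_gr j x else 0.
Proof. by apply: val_inj; rewrite /= gr_gr; case: ifP. Qed.
Lemma ospS_gr_sum x : ospS_gr false x + ospS_gr true x = x.
Proof. by apply: val_inj; apply: gr_sum. Qed.
HB.instance Definition _ :=
  isGraded.Build ospS_type ospS_grD ospS_gr_gr ospS_gr_sum.

Lemma ospS_homE i (x : ospS_type) : hom i x <-> hom i (x : Endo _).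
Proof. by split=> [h|h]; [apply: (congr1 val h)|apply: val_inj]. Qed.

Lemma ospS_grZ i j (k : K) (x : ospS_type) : hom i k -> hom j x -> hom (i (+) j) (k *: x).
Proof. by move=> hk /ospS_homE hx; apply/ospS_homE; apply: grZ. Qed.
HB.instance Definition _ := isSuperModule.Build K ospS_type ospS_grZ.

Lemma ospS_rscale (x : ospS_type) (k : K) :
  ospS_val (x *r k) = (x : Endo _) *r k.
Proof.
elim/hom_ind: x => [x x' Px Px'|i x hx].
  by rewrite rscaleDl /= Px Px' -rscaleDl.
elim/hom_ind: k => [k k' Pk Pk'|j k hk].
  by rewrite !rscaleDr /= Pk Pk'.
have /ospS_homE hx' := hx; rewrite (rscale_hom hk hx) (rscale_hom hk hx').
by case: (j && i).
Qed.

Lemma Emn_in m n : ospS E (Emn q m n).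
Proof. by apply: (@ospS_eosp _ _ _ _ E) => N _ _; apply; exists m, n. Qed.

Lemma scomm_in (x y : ospS_type) : ospS E (scomm x y).
Proof. by have [_ _] := ospS_subalg E; apply; apply: ospS_valP. Qed.

Definition Einf : Type := (resK A^o * resK M * resK M * ospS_type)%type.
HB.instance Definition _ := SuperModule.on Einf.

Definition mkL (a : A) (m n : M) (x : ospS_type) : Einf := (a, m, n, x).
Definition La (u : Einf) : A := u.1.1.1.
Definition Lm (u : Einf) : M := u.1.1.2.
Definition Ln (u : Einf) : M := u.1.2.
Definition Lx (u : Einf) : ospS_type := u.2.

(* [sapp m x] is (-1)^(|x||m|) x(m), extended linearly.                      *)
Definition sapp (m : M) (x : Endo (resK M)) : M :=
  koszul (fun (m' : M) (x' : Endo (resK M)) => x' m' : M) m x.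

Definition Lbr (u v : Einf) : Einf :=
  let: (a, m, n, x) := (La u, Lm u, Ln u, Lx u) in
  let: (a', m', n', x') := (La v, Lm v, Ln v, Lx v) in
  mkL (q m n' - q n m')
      (a *: m' + x m' - m *r a' - sapp m x')
      (- (a *: n') + x n' + n *r a' - sapp n x')
      (toE (Emn_in m n') + toE (Emn_in n m') + toE (scomm_in x x')).

Lemma sapp_biadd0 : biadd (fun (m : M) (x : Endo (resK M)) => x m : M).
Proof. by split=> [x m m'|m x x'] //; exact: (EndoD x m m'). Qed.

Lemma sapp_biadd : biadd sapp.
Proof. exact/koszul_biadd/sapp_biadd0. Qed.

Lemma sapp_rscale m x (k : K) : sapp m (x *r k) = (sapp m x : resK M) *r k.
Proof.
have [sl sr] := sapp_biadd.
elim/hom_ind: m => [m m' Pm Pm'|i m hm].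
  by rewrite !sl Pm Pm' [RHS]rscaleDl.
elim/hom_ind: x => [x x' Px Px'|j x hx].
  by rewrite rscaleDl !sr Px Px' [RHS]rscaleDl.
elim/hom_ind: k => [k k' Pk Pk'|l k hk].
  by rewrite !rscaleDr !sr Pk Pk'.
rewrite /sapp (koszulE sapp_biadd0 hm (hom_rscale hk hx)).
rewrite (koszulE sapp_biadd0 hm hx) Endo_rscaleE.
rewrite (sg_morph (f := fun v : resK M => v *r k)); last exact: rscaleDl.
have hm' : hom i (m : resK M) := hm.
have -> : k *: (m : resK M) = sg (l && i) ((m : resK M) *r k).
  by rewrite (rscale_hom hk hm') sgsg addbb.
rewrite (sg_morph (f := x)); last exact: EndoD.
by rewrite EndoZ [LHS]sgsg; case: (i); case: (j); case: (l).
Qed.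

Lemma EinfP (u v : Einf) : La u = La v -> Lm u = Lm v -> Ln u = Ln v ->
  (Lx u : Endo _) = Lx v -> u = v.
Proof.
case: u => [[[a m] n] x]; case: v => [[[a' m'] n'] x'] /=.
by rewrite /La /Lm /Ln /Lx /= => -> -> -> /val_inj ->.
Qed.

Lemma Einf_rscale (u : Einf) (k : K) :
  u *r k = mkL (La u * kscale k 1) (Lm u *r kscale k 1) (Ln u *r kscale k 1)
               (Lx u *r k).
Proof.
case: u => [[[a m] n] x]; rewrite !prod_rscale /= !resK_rscaleE.
by rewrite regular_rscale.
Qed.

Let add4 (V : zmodType) (s s' t t' u u' v v' : V) :
  (s + s') + (t + t') + (u + u') + (v + v') =
  (s + t + u + v) + (s' + t' + u' + v').
Proof. by rewrite (addrACA s) (addrACA (s + t)) (addrACA (s + t + u)). Qed.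

Lemma ad_additive (u : Einf) : {morph Lbr u : v w / v + w}.
Proof.
move=> v w; apply: EinfP; rewrite /Lbr /La /Lm /Ln /Lx /=.
- by rewrite !(qf_biadd q).2 opprD addrACA.
- rewrite scalerDr (EndoD u.2) rscaleDr sapp_biadd.2 !opprD; exact: add4.
- rewrite scalerDr (EndoD u.2) rscaleDr sapp_biadd.2 !opprD; exact: add4.
- rewrite !(Emn_biadd q).2 (scomm_biadd _).2.
  by rewrite [X in X + _ = _]addrACA [LHS]addrACA.
Qed.

Lemma ad_linear (u v : Einf) (k : K) : Lbr u (v *r k) = Lbr u v *r k.
Proof.
have Ek (x : Endo (resK M)) (m : M) :
    x (m *r kscale k (1 : A)) = (x m : M) *r kscale k (1 : A).
  by rewrite -!resK_rscaleE EndoZ.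
have Sk m x : sapp m (x *r k) = sapp m x *r kscale k (1 : A).
  by rewrite sapp_rscale resK_rscaleE.
rewrite !Einf_rscale; apply: EinfP; rewrite /Lbr /La /Lm /Ln /Lx /=.
- by rewrite !qf_right mulrBl.
- by rewrite scaler_rscale Ek -rscaleA ospS_rscale Sk -!rscaleN -!rscaleDl.
- by rewrite scaler_rscale Ek -rscaleA ospS_rscale Sk -!rscaleN -!rscaleDl.
- rewrite !ospS_rscale /= -!resK_rscaleE !Emn_rscale scomm_rscale.
  by rewrite -!rscaleDl.
Qed.

Definition ad (u : Einf) : Endo Einf := MkEndo (ad_additive u) (@ad_linear u).

Definition adL : set (Endo Einf) := [set d | exists u, d = ad u].

Definition Lzero : set Einf := [set u | exists a x, u = mkL a 0 0 x].
Definition Lplus : set Einf := [set u | exists m, u = mkL 0 m 0 0].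
Definition Lminus : set Einf := [set u | exists n, u = mkL 0 0 n 0].

Definition adLzero : set (Endo Einf) := [set d | exists2 u, Lzero u & d = ad u].

Definition Der0 : set (Endo Einf) :=
  [set d | [/\ Der Lbr d, forall u, Lzero u -> Lzero (d u),
               forall u, Lplus u -> Lplus (d u) & forall u, Lminus u -> Lminus (d u)]].

Definition AId : set (Endo (resK M)) := [set x | exists a : A, x = aId M a].

Definition hom_S : set (Endo (resK M)) :=
  [set S | (exists i, hom i S) /\
     [/\ forall a : A, AId (scomm S (aId M a)),
         forall i j (m n : M), hom i m -> hom j n ->
           scomm S (aId M (q m n)) =
           aId M (q (S m) n + sg (i && j) (q (S n) m))
       & forall x, ospS E x -> ospS E (scomm S x)]].

Definition hom_T : set (Endo (resK M)) :=
  [set T | (exists i, hom i T) /\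
     [/\ forall a : A, ospS E (scomm T (aId M a)),
         forall i j (m n : M), hom i m -> hom j n ->
           scomm T (aId M (q m n)) =
           Emn q (T m) n + sg (i && j) (Emn q (T n) m)
       & forall x, ospS E x -> AId (scomm T x)]].

Definition SE : set (Endo (resK M)) := kspan hom_S.
Definition TE : set (Endo (resK M)) := kspan hom_T.

Definition STbr (u v : Endo (resK M) * Endo (resK M)) :
    Endo (resK M) * Endo (resK M) :=
  (scomm u.1 v.1 + scomm u.2 v.2, scomm u.1 v.2 + scomm u.2 v.1).

Definition is_dST (S T : Endo (resK M)) (d : Endo Einf) : Prop :=
  forall a m n x, let w := d (mkL a m n x) in
    [/\ aId M (La w) = scomm S (aId M a) + scomm T x,
        Lm w = (S + T) m, Ln w = (S - T) n
      & ospS_val (Lx w) = scomm T (aId M a) + scomm S x].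

(* By [dSTP] and [dST_unique] below, [dST S T] is the map d_{S,T} when S is   *)
(* in [SE], T is in [TE] and the annihilator of M in A is zero.               *)
Definition dST (S T : Endo (resK M)) : Endo Einf := xget 0 (is_dST S T).

Definition DST (X Y : set (Endo (resK M))) : set (Endo Einf) :=
  [set d | exists S T, [/\ X S, Y T & d = dST S T]].

Definition DM : set (Endo Einf) := DST SE TE.

Lemma aIdD : {morph aId M : a b / a + b}.
Proof. by move=> a b; apply: Endo_eq => m; exact: (@scalerDl A M). Qed.

Lemma aId_scale (k : K) a : k *: aId M a = aId M (kscale k 1 * a).
Proof. by apply: Endo_eq => m; apply: (@scalerA A M). Qed.

Lemma aId_rscale (k : K) a : aId M a *r k = aId M (a * kscale k 1).
Proof.
apply: Endo_eq => m; rewrite Endo_rscaleE /= resK_scaleE; exact: (@scalerA A M).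
Qed.

Lemma AId_submod : is_submod AId.
Proof.
split=> [|x y [a ->] [b ->]|k x [a ->]].
- by exists 0; apply: Endo_eq => m; rewrite /= scale0r.
- by exists (a + b); rewrite aIdD.
- by exists (kscale k 1 * a); rewrite aId_scale.
Qed.

Lemma kspan_scomm (P N : set (Endo (resK M))) (y : Endo (resK M)) :
  is_submod N -> (forall x, P x -> N (scomm x y)) ->
  forall x, kspan P x -> N (scomm x y).
Proof.
move=> [N0 ND NZ] PN x Px.
apply: (Px [set x | N (scomm x y)]) => //; split=> [|u v Nu Nv|k v Nv] /=.
- by rewrite (biadd0l (@scomm_biadd _ _)).
- by rewrite (scomm_biadd _).1; apply: ND.
- by rewrite scomm_scale; apply: NZ.
Qed.

Hypothesis annM : forall a : A, (forall m : M, a *: m = 0) -> a = 0.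

Lemma aId_inj : injective (aId M).
Proof.
move=> a b ab; apply/eqP; rewrite -subr_eq0; apply/eqP/annM => m.
have e : a *: m = b *: m := congr1 (fun f : Endo (resK M) => f m : M) ab.
by rewrite scalerBl e subrr.
Qed.

Lemma dST_unique S T d d' : is_dST S T d -> is_dST S T d' -> d = d'.
Proof.
move=> dP d'P; apply: Endo_eq => -[[[a m] n] x].
have [e1 e2 e3 e4] := dP a m n x; have [f1 f2 f3 f4] := d'P a m n x.
apply: EinfP; [apply: aId_inj|..].
- by rewrite e1 -f1.
- by rewrite e2 -f2.
- by rewrite e3 -f3.
- by rewrite e4 -f4.
Qed.

Lemma dSTP S T : SE S -> TE T -> is_dST S T (dST S T).
Proof.
move=> hS hT; apply: xgetPex.
have [Esub _] := ospS_submod.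
have [A0 AD AZ] := AId_submod; have [E0 ED EZ] := Esub.
have exA u : exists b, aId M b = scomm S (aId M (La u)) + scomm T (Lx u).
  suff [b ->] : AId (scomm S (aId M (La u)) + scomm T (Lx u)) by exists b.
  apply: AD.
    by apply: kspan_scomm hS => [|x [_ []]]; [exact: AId_submod|].
  apply: kspan_scomm hT => [|x [_ [_ _]]]; [exact: AId_submod|].
  by apply; apply: ospS_valP.
have exE u : ospS E (scomm T (aId M (La u)) + scomm S (Lx u)).
  apply: ED; first by apply: kspan_scomm hT => [|x [_ []]].
  apply: kspan_scomm hS => [|x [_ [_ _]]] //.
  by apply; apply: ospS_valP.
pose f u : Einf := mkL (projT1 (cid (exA u))) (S (Lm u) + T (Lm u))
  (S (Ln u) - T (Ln u)) (toE (exE u)).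
have fA u : aId M (La (f u)) = scomm S (aId M (La u)) + scomm T (Lx u).
  by rewrite /f /La /=; case: cid.
have fD : {morph f : u v / u + v}.
  move=> u v; apply: EinfP; [apply: aId_inj|..].
  - rewrite [RHS](aIdD (La (f u)) (La (f v))) !fA aIdD !(scomm_biadd _).2.
    exact: addrACA.
  - by rewrite /Lm /= !EndoD; apply: addrACA.
  - by rewrite /Ln /= !EndoD opprD; apply: addrACA.
  - rewrite /La /Lx /= aIdD !(scomm_biadd _).2; exact: addrACA.
have fZ u (k : K) : f (u *r k) = f u *r k.
  rewrite Einf_rscale [RHS]Einf_rscale; apply: EinfP; [apply: aId_inj|..].
  - rewrite fA [RHS]/(aId M (La (f u) * _)) -[RHS]aId_rscale fA.
    rewrite [La _]/(La u * _) [Lx _]/(Lx u *r k) -aId_rscale ospS_rscale.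
    by rewrite !scomm_rscale -rscaleDl.
  - by rewrite /Lm /= -!resK_rscaleE !EndoZ -rscaleDl.
  - by rewrite /Ln /= -!resK_rscaleE !EndoZ -rscaleN -rscaleDl.
  - rewrite /La /Lx /= ospS_rscale -!aId_rscale ospS_rscale !scomm_rscale.
    by rewrite -rscaleDl.
by exists (MkEndo fD fZ) => a m n x; split=> //=; rewrite fA.
Qed.
End OspSubalgType.

Arguments Lbr {K A M q} E u v.
Arguments DST {K A M q} E X Y.
Arguments dST {K A M q} E S T.
Arguments Der0 {K A M q} E _.
Arguments DM {K A M q} E _.
Arguments SE {K A M q} E _.
Arguments TE {K A M q} E _.
Arguments adL {K A M q} E _.
Arguments adLzero {K A M q} E _.
Arguments AId {K A} M _.

(* Main.v *)
From HB Require Import structures.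
From mathcomp Require Import all_boot all_algebra.
From mathcomp Require Import boolp classical_sets functions.
Require Import Defs.

Set Implicit Arguments.
Unset Strict Implicit.
Unset Printing Implicit Defensive.

Import GRing.Theory.
Local Open Scope classical_set_scope.
Local Open Scope ring_scope.

(** An element u = (a, m, n, x) of L acts on L_+ by a + x and on L_- by
    -a + x.  Since 1/2 lies in K and A acts faithfully on M, u is determined
    by the coordinates (P, Q, m, n), where P = a + x and Q = -a + x.  In these
    coordinates the product of L is the one of the Tits-Kantor-Koecher algebra
    of the pair (M, M) with triple product D(m, n) p, where
    D(m, n) = q(m, n) Id + E_{m,n}: the P-component of [u, u'] is
    [P, P'] + D(m, n') -+ D(m', n), the m-component is P m' -+ P' m, and the
    Q- and n-components are obtained by exchanging P with Q and m with n.

    The Jacobi identity then needs only two facts: D(m, n) p is supersymmetric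
    in m and p, and (P, Q) is a derivation of the pair, that is,
    [P, D(m, n)] = D(P m, n) +- D(m, Q n), and the same with P and Q exchanged.
    One computation ([jacobiM], [jacobiP]) shows more: if (U, W) is any
    derivation of the pair, the formula for the product with the quadruple
    (U, W, m, n) defines a derivation of L ([der_criterion]).  The quadruple of
    an element u of L gives ad(u); the quadruple (S + T, S - T, 0, 0) gives
    d_{S,T}, because the conditions that relate S and T to q say that (S, S)
    and (T, -T) are derivations of the pair.  So D_M consists of derivations that
    preserve the L_sigma.

    Conversely, let d be a derivation that preserves the L_sigma, and let P and
    N be its restrictions to L_+ and L_-.  With S = (P + N)/2 and T = (P - N)/2,
    the derivation rule on [L_0, L_+] and [L_0, L_-] says that d = d_{S,T}, and
    on [L_+, L_-] it gives the conditions on [S, q(m, n)] and [T, q(m, n)],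
    mixed with [T, E_{m,n}] and [S, E_{m,n}].  They are separated by exchanging
    m and n, which multiplies q(m, n) and E_{m,n} by opposite signs
    ([Der0_hom_dST]).  Hence D_M = (Der L)_0.  The closure of S + T under the
    product, and the fact that d_{S,T} respects it, follow because (Der L)_0 is
    closed under commutators and a derivation in it is determined by its
    restrictions to L_+ and L_-.

    The element zeta = (1, 0, 0, 0) acts on L_sigma by the scalar sigma.  If d
    is a derivation, then d(zeta) can be moved into L_0 by subtracting an inner
    derivation, and then d preserves the eigenspaces of ad(zeta), as 2 is
    invertible; hence Der L = ad L + D_M ([Der_decomp]).  Moreover ad(u)
    preserves the L_sigma only if ad(u)(zeta) lies in L_0, that is, if u lies in
    L_0, and for such u it is d_{x,a}; this gives the intersection of ad L and D_M
    ([adL_DM], [inner_eq_adLzero]).  The semidirect decomposition follows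
    because d_{S,T} determines S and T. *)

(** * Identities up to signs in abelian groups *)

(** Signs are reified with their symbolic exponents: the reflected equation
    mentions the degrees only, and is decided by running through their values. *)
Inductive zexpr :=
  ZVar of nat | ZZero | ZAdd of zexpr & zexpr | ZOpp of zexpr
| ZSign of bool & zexpr.

Fixpoint zcoef (e : zexpr) (n : nat) : int :=
  match e with
  | ZVar k => (k == n)%:Z
  | ZZero => 0
  | ZAdd e1 e2 => zcoef e1 n + zcoef e2 n
  | ZOpp e1 => - zcoef e1 n
  | ZSign b e1 => if b then - zcoef e1 n else zcoef e1 n
  end.

Section Reflection.
Variables (V : zmodType) (env : seq V).

Fixpoint zeval (e : zexpr) : V :=
  match e with
  | ZVar k => nth 0 env k
  | ZZero => 0
  | ZAdd e1 e2 => zeval e1 + zeval e2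
  | ZOpp e1 => - zeval e1
  | ZSign b e1 => sg b (zeval e1)
  end.

Lemma zevalE (e : zexpr) :
  zeval e = \sum_(n < size env) nth 0 env n *~ zcoef e n.
Proof.
elim: e => [k||e1 IH1 e2 IH2|e1 IH1|b e1 IH1] /=.
- case: (ltnP k (size env)) => hk.
    rewrite (bigD1 (Ordinal hk)) //= eqxx mulr1z big1 ?addr0 // => n.
    by rewrite -val_eqE /= eq_sym => /negPf ->; rewrite mulr0z.
  rewrite nth_default // big1 // => n _.
  by rewrite gtn_eqF ?mulr0z // (leq_trans (ltn_ord n)).
- by rewrite big1 // => n _; rewrite mulr0z.
- by rewrite IH1 IH2 -big_split; apply: eq_bigr => n _; rewrite mulrzDr.
- by rewrite IH1 -sumrN; apply: eq_bigr => n _; rewrite mulrNz.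
- case: b; rewrite /= IH1 //.
  by rewrite -sumrN; apply: eq_bigr => n _; rewrite mulrNz.
Qed.

Lemma zexpr_eq (e1 e2 : zexpr) :
  all (fun n => zcoef e1 n == zcoef e2 n) (iota 0 (size env)) ->
  zeval e1 = zeval e2.
Proof.
move=> /allP e12; rewrite !zevalE; apply: eq_bigr => n _.
by rewrite (eqP (e12 n _)) // mem_iota /= ltn_ord.
Qed.
End Reflection.

Ltac zmod_index x l :=
  lazymatch l with
  | ?y :: ?l' =>
    match constr:(Set) with
    | _ => let _ := match constr:(Set) with _ => constr_eq x y end in
           constr:(0%N)
    | _ => let k := zmod_index x l' in constr:(S k)
    end
  | _ => constr:(0%N)
  end.
Ltac zmod_add x l :=
  lazymatch l with
  | ?y :: ?l' =>
    match constr:(Set) with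
    | _ => let _ := match constr:(Set) with _ => constr_eq x y end in l
    | _ => let l'' := zmod_add x l' in constr:(y :: l'')
    end
  | _ => constr:([:: x])
  end.
Ltac zmod_atoms t l :=
  lazymatch t with
  | GRing.zero => l
  | GRing.add ?a ?b => let l' := zmod_atoms a l in zmod_atoms b l'
  | GRing.opp ?a => zmod_atoms a l
  | sg _ ?a => zmod_atoms a l
  | _ => zmod_add t l
  end.
Ltac zmod_reify t l :=
  lazymatch t with
  | GRing.zero => constr:(ZZero)
  | GRing.add ?a ?b =>
    let a' := zmod_reify a l in let b' := zmod_reify b l in constr:(ZAdd a' b')
  | GRing.opp ?a => let a' := zmod_reify a l in constr:(ZOpp a')
  | sg ?c ?a => let a' := zmod_reify a l in constr:(ZSign c a')
  | _ => let k := zmod_index t l in constr:(ZVar k)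
  end.
Ltac zmod_goal :=
  lazymatch goal with
  | |- @eq _ ?x ?y =>
    let T := type of (@GRing.opp _ x) in
    let l := zmod_atoms x (@nil T) in let l := zmod_atoms y l in
    let ex := zmod_reify x l in let ey := zmod_reify y l in
    apply: (@zexpr_eq _ l ex ey)
  end.
Ltac bool_cases :=
  repeat match goal with b : bool |- context [?b] => is_var b; destruct b end.
(** The identity [reverse_coercion], left in types by elaboration, would make
    equal atoms differ syntactically.  Hypotheses are cleared as they may depend
    on the degrees, which are destructed. *)
Ltac zmod := cbv beta delta [reverse_coercion]; zmod_goal; cbv beta iota delta [size iota];
  repeat match goal with
  | H : ?T |- _ => lazymatch T with bool => fail | _ => clear H end end;
  bool_cases; vm_compute; reflexivity.

(** * The Jacobi identity for a pair with triple product D *)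

Section PairJacobi.
Variables (K : scRingType) (V : supermodType K) (D : V -> V -> Endo V).
Hypothesis DD : biadd D.
Hypothesis D_hom : forall i j (m n : V), hom i m -> hom j n ->
  hom (i (+) j) (D m n).
Hypothesis D_swap : forall i j k (m n p : V), hom i m -> hom j n -> hom k p ->
  D m n p = sg ((i && j) (+) (i && k) (+) (j && k)) (D p n m).

(** (U, W) acts as a derivation of degree i on the triple product
    D m n p, where m and p lie in the first and n in the second copy of V. *)
Definition compat (i : bool) (U W : Endo V) : Prop :=
  forall j k (m n : V), hom j m -> hom k n ->
    scomm U (D m n) = D (U m) n + sg (i && j) (D m (W n)).

Lemma compatD i U W U' W' : compat i U W -> compat i U' W' ->
  compat i (U + U') (W + W').
Proof.
move=> c c' j k m n hm hn.
rewrite (proj1 (scomm_biadd _)) (c j k) // (c' j k) // !Endo_addE DD.1 DD.2 sgD.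
by rewrite addrACA.
Qed.

(** Elements are quadruples (P, Q, m, n).  This is the P-component of the
    product of elements of degrees i and j; the Q-component is obtained by
    exchanging P with Q and m with n. *)
Definition brP (i j : bool) (P P' : Endo V) (m n m' n' : V) : Endo V :=
  scomm P P' + D m n' - sg (i && j) (D m' n).
Definition brM (i j : bool) (P P' : Endo V) (m m' : V) : V :=
  P m' - sg (i && j) (P' m).

Lemma Endo_sgr (U : Endo V) b v : U (sg b v) = sg b (U v).
Proof. exact/sg_morph/EndoD. Qed.
Lemma Dsgl b m n : D (sg b m) n = sg b (D m n).
Proof. exact/(sg_morph (f := fun m => D m n))/DD.1. Qed.
Lemma Dsgr b m n : D m (sg b n) = sg b (D m n).
Proof. exact/(sg_morph (f := D m))/DD.2. Qed.
Lemma DNl m n : D (- m) n = - D m n.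
Proof. exact: (Dsgl true). Qed.
Lemma DNr m n : D m (- n) = - D m n.
Proof. exact: (Dsgr true). Qed.

Lemma Endo_hom_app i j (U : Endo V) v : hom i U -> hom j v -> hom (i (+) j) (U v).
Proof. by move=> /Endo_homP; apply. Qed.

Lemma hom_scomm i j (U W : Endo V) : hom i U -> hom j W ->
  hom (i (+) j) (scomm U W).
Proof.
move=> hU hW; rewrite (scomm_hom hU hW).
have c a b (X Y : Endo V) : hom a X -> hom b Y -> hom (a (+) b) (Endo_comp X Y).
  move=> hX hY; apply/Endo_homP => l v hv; rewrite -addbA.
  exact: (Endo_hom_app hX (Endo_hom_app hY hv)).
by apply: homD; [apply: c|apply/homN/hom_sg; rewrite addbC; apply: c].
Qed.

Lemma scomm_sym i j (x y : Endo V) : hom i x -> hom j y ->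
  scomm x y = - sg (i && j) (scomm y x).
Proof.
move=> hx hy; rewrite (scomm_hom hx hy) (scomm_hom hy hx); zmod.
Qed.

Lemma scommNl x y : scomm (- x) y = - scomm x y :> Endo V.
Proof. exact: (sg_morph (f := fun x => scomm x y) true _ ((scomm_biadd V).1 y)). Qed.
Lemma scommNr x y : scomm x (- y) = - scomm x y :> Endo V.
Proof. exact: (sg_morph (f := scomm x) true _ ((scomm_biadd V).2 x)). Qed.

Lemma hom_brP i j P P' m n m' n' : hom i P -> hom i m -> hom i n ->
  hom j P' -> hom j m' -> hom j n' -> hom (i (+) j) (brP i j P P' m n m' n').
Proof.
move=> *; apply: homD; [apply: homD|apply/homN/hom_sg].
- exact: hom_scomm.
- exact: D_hom.
- by rewrite addbC; apply: D_hom.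
Qed.

Lemma hom_brM i j P P' m m' : hom i P -> hom i m -> hom j P' -> hom j m' ->
  hom (i (+) j) (brM i j P P' m m').
Proof.
move=> *; apply: homD; first exact: Endo_hom_app.
by apply/homN/hom_sg; rewrite addbC; apply: Endo_hom_app.
Qed.

Lemma scommE i j (U W : Endo V) v : hom i U -> hom j W ->
  scomm U W v = U (W v) - sg (i && j) (W (U v)).
Proof. by move=> hU hW; rewrite (scomm_hom hU hW) Endo_addE Endo_oppE Endo_sgE. Qed.

Let evE := (Endo_addE, Endo_oppE, Endo_sgE).
Let evL := (EndoD, EndoN, Endo_sgr).
Let DL := (DD.1, DD.2, DNl, DNr, Dsgl, Dsgr).

Section Jacobi.
Variables (i j k : bool) (P1 P2 P3 Q1 Q2 Q3 : Endo V) (m1 m2 m3 n1 n2 n3 : V).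
Hypothesis (hP1 : hom i P1) (hP2 : hom j P2) (hP3 : hom k P3).
Hypothesis (hQ1 : hom i Q1) (hQ2 : hom j Q2) (hQ3 : hom k Q3).
Hypothesis (hm1 : hom i m1) (hm2 : hom j m2) (hm3 : hom k m3).
Hypothesis (hn1 : hom i n1) (hn2 : hom j n2) (hn3 : hom k n3).
Hypothesis (c1 : compat i P1 Q1) (c2 : compat j P2 Q2) (c3 : compat k P3 Q3).

Let C := (fun w => scommE w hP2 hP3, fun w => scommE w hP1 hP3,
  fun w => scommE w hP1 hP2, evE).

(** The terms without D cancel because of the definition of the commutator;
    those with D cancel in pairs by [D_swap]. *)
Lemma jacobiM :
  brM i (j (+) k) P1 (brP j k P2 P3 m2 n2 m3 n3) m1 (brM j k P2 P3 m2 m3) =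
  brM (i (+) j) k (brP i j P1 P2 m1 n1 m2 n2) P3 (brM i j P1 P2 m1 m2) m3
  + sg (i && j)
     (brM j (i (+) k) P2 (brP i k P1 P3 m1 n1 m3 n3) m2 (brM i k P1 P3 m1 m3)).
Proof.
rewrite /brM /brP !C.
rewrite (D_swap hm3 hn1 hm2) (D_swap hm3 hn2 hm1) (D_swap hm2 hn3 hm1).
rewrite !evL.
zmod.
Qed.

(** The derivation property expresses each D (P m) n through a commutator
    and D m (Q n); then everything cancels. *)
Lemma jacobiP :
  brP i (j (+) k) P1 (brP j k P2 P3 m2 n2 m3 n3) m1 n1
      (brM j k P2 P3 m2 m3) (brM j k Q2 Q3 n2 n3) =
  brP (i (+) j) k (brP i j P1 P2 m1 n1 m2 n2) P3
      (brM i j P1 P2 m1 m2) (brM i j Q1 Q2 n1 n2) m3 n3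
  + sg (i && j)
     (brP j (i (+) k) P2 (brP i k P1 P3 m1 n1 m3 n3) m2 n2
      (brM i k P1 P3 m1 m3) (brM i k Q1 Q3 n1 n3)).
Proof.
have c a b c U W m n : hom a U -> hom b m -> hom c n -> compat a U W ->
    D (U m) n = scomm U (D m n) - sg (a && b) (D m (W n)).
  by move=> hU hm hn cU; rewrite (cU b c) // addrK.
rewrite {1 3 5}/brP /brM !DL.
rewrite (c _ _ _ _ _ _ _ hP2 hm3 hn1 c2) (c _ _ _ _ _ _ _ hP3 hm2 hn1 c3).
rewrite (c _ _ _ _ _ _ _ hP1 hm2 hn3 c1) (c _ _ _ _ _ _ _ hP2 hm1 hn3 c2).
rewrite (c _ _ _ _ _ _ _ hP1 hm3 hn2 c1) (c _ _ _ _ _ _ _ hP3 hm1 hn2 c3).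
have hD a b (x y : V) : hom a x -> hom b y -> hom (a (+) b) (D x y) by exact: D_hom.
apply: Endo_eq => v.
pose C' := (fun w => scommE w hP1 (hom_brP hP2 hm2 hn2 hP3 hm3 hn3),
   fun w => scommE w hP2 (hom_brP hP1 hm1 hn1 hP3 hm3 hn3),
   fun w => scommE w (hom_brP hP1 hm1 hn1 hP2 hm2 hn2) hP3,
   fun w => scommE w hP2 (hD _ _ _ _ hm3 hn1),
   fun w => scommE w hP3 (hD _ _ _ _ hm2 hn1),
   fun w => scommE w hP1 (hD _ _ _ _ hm2 hn3),
   fun w => scommE w hP2 (hD _ _ _ _ hm1 hn3),
   fun w => scommE w hP1 (hD _ _ _ _ hm3 hn2),
   fun w => scommE w hP3 (hD _ _ _ _ hm1 hn2), C).
rewrite !C' !evL.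
zmod.
Qed.
End Jacobi.
End PairJacobi.

(** * Graded submodules and spans of homogeneous elements *)

Section Graded.
Variables (K : scRingType) (V : supermodType K).

Lemma gr_scaleE i (k : K) (v : V) :
  gr i (k *: v) = gr false k *: gr i v + gr true k *: gr (~~ i) v.
Proof.
rewrite -{1}(gr_sum k) scalerDl grD !(gr_scale _ _ (hom_gr _ _)).
by rewrite addbF addbT.
Qed.

Lemma kspan_sub (P : set V) : P `<=` kspan P.
Proof. by move=> v Pv N _; apply. Qed.

Lemma kspan_submod (P : set V) : is_submod (kspan P).
Proof.
split=> [N [] //|u v Pu Pv N sN PN|k v Pv N sN PN].
- by have [_ D _] := sN; apply: D; [apply: Pu|apply: Pv].
- by have [_ _ Z] := sN; apply: Z; apply: Pv.
Qed.

Lemma kspan_gsubmod (P : set V) :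
  (forall v, P v -> exists i, hom i v) -> is_gsubmod (kspan P).
Proof.
move=> homP; have [s0 sD sZ] := kspan_submod P; split=> // i v.
move=> /(_ [set w | forall j, kspan P (gr j w)]); apply=> {i v}.
- split=> [j|u v Pu Pv j|k v Pv j]; first by rewrite gr0.
  + by rewrite grD; apply: sD.
  + by rewrite gr_scaleE; apply: sD; apply: sZ.
- move=> v Pv j; have [i hv] := homP v Pv.
  by rewrite (gr_hom j hv); case: eqP => // _; apply: kspan_sub.
Qed.

(** The vectors whose homogeneous components all lie in P form a submodule,
    as P is stable under sums of the same degree and homogeneous scalars. *)
Lemma kspan_gr (P : set V) :
  (forall v, P v -> exists i, hom i v) -> P 0 ->
  (forall i u v, hom i u -> hom i v -> P u -> P v -> P (u + v)) ->
  (forall i (k : K) v, hom i k -> P v -> P (k *: v)) ->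
  forall i v, kspan P v -> P (gr i v).
Proof.
move=> homP P0 PD PZ i v.
move=> /(_ [set w | forall j, P (gr j w)]); apply=> {i v}.
- split=> [j|u v Pu Pv j|k v Pv j]; first by rewrite gr0.
  + by rewrite grD; apply: (PD j) => //; apply: hom_gr.
  + rewrite gr_scaleE; apply: (PD j).
    * by rewrite -{1}[j]addFb; apply: grZ; apply: hom_gr.
    * by rewrite -{1}[j]negbK -addTb; apply: grZ; apply: hom_gr.
    * by apply: (PZ false) => //; apply: hom_gr.
    * by apply: (PZ true) => //; apply: hom_gr.
- move=> v Pv j; have [i hv] := homP v Pv.
  by rewrite (gr_hom j hv); case: eqP.
Qed.

Lemma dbl_inj : (exists h : K, h *+ 2 = 1) -> forall u v : V,
  u + u = v + v -> u = v.
Proof.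
move=> [h h2] u v uv; rewrite -(scale1r u) -(scale1r v) -h2 mulr2n !scalerDl.
by rewrite -!scalerDr uv.
Qed.

(** As 1 is even, the even part of 1/2 is again 1/2; scaling by it keeps degrees. *)
Lemma even_half : (exists h : K, h *+ 2 = 1) ->
  exists2 h : K, hom false h & h + h = 1.
Proof.
move=> [h h2]; exists (gr false h); first exact: hom_gr.
by rewrite -grD -mulr2n h2; apply: gr1.
Qed.
End Graded.

(** * The triple product of a quadratic form *)

Section QuadraticPair.
Variables (K : scRingType) (A : superextType K) (M : supermodType A).
Variable q : quadform M.
Local Notation V := (resK M).
Local Notation "a %:I" := (aId M a) (at level 2, format "a %:I").

Lemma aId_sg b a : (sg b a)%:I = sg b (a%:I).
Proof. exact/(sg_morph (f := aId M))/aIdD. Qed.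

Lemma aIdDE a b v : (a + b)%:I v = a%:I v + b%:I v :> V.
Proof. by rewrite aIdD. Qed.

Lemma aIdsgE a b v : (sg b a)%:I v = sg b (a%:I v) :> V.
Proof. by rewrite aId_sg Endo_sgE. Qed.

Lemma aId_hom i (a : A) : hom i a -> hom i (a%:I).
Proof. by move=> ha; apply/Endo_homP => j v hv; apply: (@grZ A M). Qed.

(** The signs from moving a through m, through n and through q(m,n) cancel. *)
Lemma q_left a (m n : M) : q (a *: m) n = a * q m n.
Proof.
have [ql qr] := qf_biadd q.
elim/hom_ind: m => [m m' Pm Pm'|i m hm].
  by rewrite scalerDr !ql Pm Pm' mulrDr.
elim/hom_ind: n => [n n' Pn Pn'|j n hn]; first by rewrite !qr Pn Pn' mulrDr.
elim/hom_ind: a => [a a' Pa Pa'|k a ha].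
  by rewrite scalerDl !ql Pa Pa' mulrDl.
have -> : a *: m = sg (k && i) (m *r a) by rewrite (rscale_hom ha hm) sgsg addbb.
rewrite (sg_morph (f := fun m => q m n)) ?qf_mid; last exact: ql.
have -> : a *: n = sg (k && j) (n *r a) by rewrite (rscale_hom ha hn) sgsg addbb.
rewrite (sg_morph (f := q m)) ?qf_right; last exact: qr.
rewrite (scommM ha (qf_even q hm hn)) !sgsg.
by congr (sg _ _); case: (i); case: (j); case: (k).
Qed.

Lemma EmnE i j k (m n p : V) : hom i m -> hom j n -> hom k p ->
  Emn q m n p = sg (i && (j (+) k)) ((q n p)%:I m) - sg (j && k) ((q m p)%:I n).
Proof.
move=> hm hn hp; have hq := qf_even q (hn : hom j (n : M)) (hp : hom k (p : M)).
rewrite /= (@rscale_hom A M _ _ _ m hq hm) andbC; congr (_ - _).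
by rewrite (koszulE (qscale_biadd0 q m) hn hp).
Qed.

Lemma Emn_hom i j (m n : V) : hom i m -> hom j n -> hom (i (+) j) (Emn q m n).
Proof.
move=> hm hn; apply/Endo_homP => k p hp; rewrite (EmnE hm hn hp).
have ap a b c (x : V) : hom a b -> hom c x -> hom (a (+) c) (b%:I x).
  by move=> hb hx; apply: (@grZ A M).
apply: homD; last apply: homN; apply: hom_sg.
- have -> : i (+) j (+) k = j (+) k (+) i by case: (i) (j) (k) => [] [] [].
  exact: (ap _ _ _ _ (qf_even q hn hp) hm).
- have -> : i (+) j (+) k = i (+) k (+) j by case: (i) (j) (k) => [] [] [].
  exact: (ap _ _ _ _ (qf_even q hm hp) hn).
Qed.

Lemma Emn_left a (x y z : V) : Emn q (a%:I x) y z = a%:I (Emn q x y z).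
Proof.
elim/hom_ind: a => [a b Pa Pb|i a ha].
  by rewrite !aIdDE (Emn_biadd q).1 [LHS]Endo_addE Pa Pb.
elim/hom_ind: x => [x x' Px Px'|l x hx].
  by rewrite EndoD !(Emn_biadd q).1 !Endo_addE Px Px' [RHS]EndoD.
elim/hom_ind: y => [y y' Py Py'|l' y hy].
  by rewrite !(Emn_biadd q).2 !Endo_addE Py Py' [RHS]EndoD.
elim/hom_ind: z => [z z' Pz Pz'|l'' z hz].
  by rewrite (EndoD (Emn q (a%:I x) y)) (EndoD (Emn q x y)) Pz Pz' [RHS]EndoD.
have hq : hom (l' (+) l'') (q y z) by apply: qf_even.
rewrite (EmnE (Endo_hom_app (aId_hom ha) hx) hy hz) (EmnE hx hy hz).
rewrite !(EndoD, EndoN, Endo_sgr) q_left.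
have -> : (a * q x z)%:I y = a%:I ((q x z)%:I y) by rewrite /= scalerA.
have -> : (q y z)%:I (a%:I x) = sg (i && (l' (+) l'')) (a%:I ((q y z)%:I x)).
  by rewrite /= !scalerA (scommM ha hq) scale_sgl sgsg addbb.
zmod.
Qed.

Lemma Emn_sym i j (m n : V) : hom i m -> hom j n ->
  Emn q m n = - sg (i && j) (Emn q n m).
Proof.
move=> hm hn; apply: Endo_eq => p; rewrite Endo_oppE Endo_sgE.
elim/hom_ind: p => [p p' Pp Pp'|k p hp].
  by rewrite !EndoD Pp Pp'; zmod.
by rewrite (EmnE hm hn hp) (EmnE hn hm hp); zmod.
Qed.

(** Leibniz rule: the commutator measures the failure of S to be A-linear. *)
Lemma Endo_aId i j (S : Endo V) (a : A) v : hom i S -> hom j a ->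
  S (a%:I v) = scomm S (a%:I) v + sg (i && j) (a%:I (S v)).
Proof. by move=> hS ha; rewrite (scommE _ hS (aId_hom ha)) subrK. Qed.

(** The operators of the Jordan pair (M, M) of the form q: up to signs,
    Dq m n p = q(m,n) p + q(n,p) m - q(m,p) n. *)
Definition Dq (m n : V) : Endo V := (q m n)%:I + Emn q m n.

Lemma Dq_biadd : biadd Dq.
Proof.
have [ql qr] := qf_biadd q; have [El Er] := Emn_biadd q.
split=> [n m m'|m n n']; rewrite /Dq ?ql ?qr ?El ?Er aIdD; exact: addrACA.
Qed.

Lemma Dq_hom i j (m n : V) : hom i m -> hom j n -> hom (i (+) j) (Dq m n).
Proof.
by move=> hm hn; apply: homD; [apply/aId_hom/qf_even|apply: Emn_hom].
Qed.

(** The first two terms of D m n p are exchanged, and the third one is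
    reproduced, when m and p are exchanged. *)
Lemma Dq_swap i j k (m n p : V) : hom i m -> hom j n -> hom k p ->
  Dq m n p = sg ((i && j) (+) (i && k) (+) (j && k)) (Dq p n m).
Proof.
move=> hm hn hp; rewrite !Endo_addE (EmnE hm hn hp) (EmnE hp hn hm).
rewrite (qf_sym q hp hn) (qf_sym q hp hm) (qf_sym q hn hm) !aIdsgE.
zmod.
Qed.

Section Compatible.
Variables (i j k : bool) (S : Endo V) (m n : V).
Hypothesis (hS : hom i S) (hm : hom j m) (hn : hom k n).

(** Expand S (E_{m,n} p) by [Endo_aId]; the hypothesis replaces [S, q(n,p)] and
    [S, q(m,p)], and the terms with S p cancel against E_{m,n} (S p). *)
Lemma scomm_Emn_S :
  (forall i j (m n : V), hom i m -> hom j n ->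
     scomm S ((q m n)%:I) = (q (S m) n + sg (i && j) (q (S n) m))%:I) ->
  scomm S (Emn q m n) = Emn q (S m) n + sg (i && j) (Emn q m (S n)).
Proof.
move=> S2; have hq a b (x y : M) : hom a x -> hom b y -> hom (a (+) b) (q x y).
  exact: qf_even.
apply: Endo_eq; elim/hom_ind => [p p' Pp Pp'|l p hp].
  by rewrite !EndoD Pp Pp'.
have hSx a x : hom a x -> hom (i (+) a) (S x) by exact: Endo_hom_app.
rewrite (scommE _ hS (Emn_hom hm hn)) Endo_addE Endo_sgE.
rewrite (EmnE hm hn hp) (EmnE hm hn (hSx _ _ hp)) (EmnE (hSx _ _ hm) hn hp).
rewrite (EmnE hm (hSx _ _ hn) hp) !(EndoD, EndoN, Endo_sgr).
rewrite (Endo_aId _ hS (hq _ _ _ _ hn hp)) (Endo_aId _ hS (hq _ _ _ _ hm hp)).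
rewrite (S2 _ _ _ _ hn hp) (S2 _ _ _ _ hm hp).
rewrite (qf_sym q hn (hSx _ _ hp)) (qf_sym q hm (hSx _ _ hp)).
rewrite !(aIdDE, aIdsgE).
zmod.
Qed.

(** The hypothesis turns [S, q(n,p)] m and [S, q(m,p)] n into values of operators
    E; once these are expanded, only two multiples of p survive. *)
Lemma scomm_Emn_T :
  (forall i j (m n : V), hom i m -> hom j n ->
     scomm S ((q m n)%:I) = Emn q (S m) n + sg (i && j) (Emn q (S n) m)) ->
  scomm S (Emn q m n) = (q (S m) n - sg (i && j) (q m (S n)))%:I.
Proof.
move=> T2; have hq a b (x y : M) : hom a x -> hom b y -> hom (a (+) b) (q x y).
  exact: qf_even.
apply: Endo_eq; elim/hom_ind => [p p' Pp Pp'|l p hp].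
  by rewrite !EndoD Pp Pp'.
have hSx a x : hom a x -> hom (i (+) a) (S x) by exact: Endo_hom_app.
rewrite (scommE _ hS (Emn_hom hm hn)).
rewrite (EmnE hm hn hp) (EmnE hm hn (hSx _ _ hp)).
rewrite !(EndoD, EndoN, Endo_sgr).
rewrite (Endo_aId _ hS (hq _ _ _ _ hn hp)) (Endo_aId _ hS (hq _ _ _ _ hm hp)).
rewrite (T2 _ _ _ _ hn hp) (T2 _ _ _ _ hm hp) !Endo_addE !Endo_sgE.
rewrite (EmnE (hSx _ _ hn) hp hm) (EmnE (hSx _ _ hp) hn hm).
rewrite (EmnE (hSx _ _ hm) hp hn) (EmnE (hSx _ _ hp) hm hn).
rewrite (qf_sym q hp hm) (qf_sym q hp hn) (qf_sym q hn hm).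
rewrite (qf_sym q hn (hSx _ _ hp)) (qf_sym q hm (hSx _ _ hp)).
rewrite (qf_sym q hm (hSx _ _ hn)).
rewrite -[- sg _ _ in RHS]/(sg true _).
rewrite !(aIdDE, aIdsgE).
zmod.
Qed.
End Compatible.

End QuadraticPair.

(** * Coordinates on L and a criterion for derivations *)

Section Coordinates.
Variables (K : scRingType) (A : superextType K) (M : supermodType A).
Variables (q : quadform M) (E : ospSubalg q).
Hypothesis half : exists h : K, h *+ 2 = 1.
Hypothesis annM : forall a : A, (forall m : M, a *: m = 0) -> a = 0.
Local Notation V := (resK M).
Local Notation "a %:I" := (aId M a) (at level 2, format "a %:I").
Local Notation L := (Einf E).
Local Notation D := (Dq q).

(** The actions of u on L_+ and, below, on L_-. *)
Definition act_p (u : L) : Endo V := (La u)%:I + Lx u.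
Definition act_m (u : L) : Endo V := - (La u)%:I + Lx u.

Lemma act_pD u v : act_p (u + v) = act_p u + act_p v.
Proof. by rewrite /act_p [La _]/(La u + La v) aIdD; apply: addrACA. Qed.
Lemma act_mD u v : act_m (u + v) = act_m u + act_m v.
Proof. by rewrite /act_m [La _]/(La u + La v) aIdD opprD; apply: addrACA. Qed.
Lemma LmD (u v : L) : Lm (u + v) = Lm u + Lm v. Proof. by []. Qed.
Lemma LnD (u v : L) : Ln (u + v) = Ln u + Ln v. Proof. by []. Qed.
Lemma act_p_sg b u : act_p (sg b u) = sg b (act_p u).
Proof. exact/sg_morph/act_pD. Qed.
Lemma act_m_sg b u : act_m (sg b u) = sg b (act_m u).
Proof. exact/sg_morph/act_mD. Qed.
Lemma Lm_sg b (u : L) : Lm (sg b u) = sg b (Lm u).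
Proof. exact/sg_morph/LmD. Qed.
Lemma Ln_sg b (u : L) : Ln (sg b u) = sg b (Ln u).
Proof. exact/sg_morph/LnD. Qed.

(** The sum and the difference of the two actions are 2 x and 2 a Id; 2 is
    invertible, and a Id determines a. *)
Lemma L_eq_coord (u v : L) :
  act_p u = act_p v -> act_m u = act_m v -> Lm u = Lm v -> Ln u = Ln v -> u = v.
Proof.
move=> ep eq em en; apply: EinfP => //.
- apply: (aId_inj annM); apply: (dbl_inj half).
  have e w : (La w)%:I + (La w)%:I = act_p w - act_m w by rewrite /act_p /act_m; zmod.
  by rewrite !e ep eq.
- apply: (dbl_inj half).
  have e w : (Lx w : Endo V) + Lx w = act_p w + act_m w by rewrite /act_p /act_m; zmod.
  by rewrite !e ep eq.
Qed.

Lemma hom_L i (u : L) : hom i u ->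
  [/\ hom i (La u), hom i (Lm u : V), hom i (Ln u : V) & hom i (Lx u : Endo V)].
Proof.
case: u => [[[a m] n] x] /prod_homE[/prod_homE[/prod_homE[ha hm] hn] hx].
by split=> //; apply/ospS_homE.
Qed.

Lemma hom_mkL i a (m n : V) (x : ospS_type E) :
  hom i a -> hom i m -> hom i n -> hom i x -> hom i (mkL a m n x).
Proof. by move=> ha hm hn hx; do 3!(apply/prod_homE; split=> //). Qed.

Lemma hom_act_p i u : hom i u -> hom i (act_p u).
Proof. by move=> /hom_L[ha _ _ hx]; apply: homD => //; apply: aId_hom. Qed.
Lemma hom_act_m i u : hom i u -> hom i (act_m u).
Proof.
by move=> /hom_L[ha _ _ hx]; apply: homD => //; apply/homN/aId_hom.
Qed.

(** Move a to the right of m, use A-linearity, and move a back to the left. *)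
Lemma EndoA_scomm i x a : hom i x -> EndoA x -> scomm x (a%:I) = 0 :> Endo V.
Proof.
move=> hx xA; elim/hom_ind: a => [a b Pa Pb|j a ha].
  by rewrite aIdD (scomm_biadd _).2 Pa Pb addr0.
rewrite (scomm_hom hx (aId_hom M ha)); apply: Endo_eq => m.
rewrite Endo_addE Endo_oppE Endo_sgE Endo_0E; apply/eqP; rewrite subr_eq0; apply/eqP.
elim/hom_ind: m => [m n Pm Pn|k m hm].
  by rewrite !EndoD Pm Pn; zmod.
have hm' : hom k (m : M) := hm.
have hxm : hom (i (+) k) (x m : M) := Endo_hom_app hx hm.
have -> : Endo_comp x (a%:I) m = sg (j && k) (x ((m : M) *r a)).
  by rewrite (rscale_hom ha hm') (sg_morph (f := x)) ?sgsg ?addbb //; apply: EndoD.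
rewrite (xA m a) (rscale_hom ha hxm) [LHS]sgsg.
by case: (i) (j) (k) => [] [] [].
Qed.

Lemma aId_EndoA a : EndoA (a%:I).
Proof. by move=> m b; apply: scaler_rscale. Qed.

Lemma E_osp x : ospS E x -> osp q x.
Proof. by have [sE _ _] := ospS_subalg E; apply: sE. Qed.

Lemma scomm_E_aId i x a : hom i x -> ospS E x -> scomm x (a%:I) = 0.
Proof. by move=> hx /E_osp[xA _]; apply: (EndoA_scomm _ hx). Qed.

Lemma scomm_aId_E i j x a : hom i a -> hom j x -> ospS E x ->
  scomm (a%:I) x = 0.
Proof.
move=> ha hx Ex; rewrite (scomm_sym (aId_hom M ha) hx) (scomm_E_aId _ hx Ex).
by rewrite sg0 oppr0.
Qed.

Lemma scomm_aId2 i a b : hom i a -> scomm (a%:I) (b%:I) = 0.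
Proof. by move=> ha; exact: (EndoA_scomm _ (aId_hom M ha) (aId_EndoA a)). Qed.

Lemma scomm_act_p i j u v : hom i u -> hom j v ->
  scomm (act_p u) (act_p v) = scomm (Lx u) (Lx v).
Proof.
move=> hu hv; have [hau _ _ hxu] := hom_L hu; have [hav _ _ hxv] := hom_L hv.
rewrite /act_p !((scomm_biadd _).1, (scomm_biadd _).2).
rewrite (scomm_aId2 _ hau) (scomm_aId_E hau hxv (ospS_valP _)).
by rewrite (scomm_E_aId _ hxu (ospS_valP _)) !add0r.
Qed.

Lemma scomm_act_m i j u v : hom i u -> hom j v ->
  scomm (act_m u) (act_m v) = scomm (Lx u) (Lx v).
Proof.
move=> hu hv; have [hau _ _ hxu] := hom_L hu; have [hav _ _ hxv] := hom_L hv.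
rewrite /act_m !((scomm_biadd _).1, (scomm_biadd _).2, scommNl, scommNr).
rewrite (scomm_aId2 _ hau) (scomm_aId_E hau hxv (ospS_valP _)).
by rewrite (scomm_E_aId _ hxu (ospS_valP _)) !(oppr0, add0r).
Qed.

Section Bracket.
Variables (i j : bool) (u v : L).
Hypothesis (hu : hom i u) (hv : hom j v).

Lemma act_p_br : act_p (Lbr E u v) =
  brP D i j (act_p u) (act_p v) (Lm u) (Ln u) (Lm v) (Ln v).
Proof.
have [_ hmu hnu _] := hom_L hu; have [_ hmv hnv _] := hom_L hv.
rewrite /brP (scomm_act_p hu hv) /act_p /Lbr /La /Lx /= /Dq.
rewrite (qf_sym q hnu hmv) (Emn_sym q hnu hmv) !aIdD (sg_morph true _ (@aIdD _ _ M)).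
rewrite aId_sg; zmod.
Qed.

Lemma act_m_br : act_m (Lbr E u v) =
  brP D i j (act_m u) (act_m v) (Ln u) (Lm u) (Ln v) (Lm v).
Proof.
have [_ hmu hnu _] := hom_L hu; have [_ hmv hnv _] := hom_L hv.
rewrite /brP (scomm_act_m hu hv) /act_m /Lbr /La /Lx /= /Dq.
rewrite (qf_sym q hmu hnv) (Emn_sym q hmu hnv) !aIdD (sg_morph true _ (@aIdD _ _ M)).
rewrite aId_sg; zmod.
Qed.

Lemma Lm_br : Lm (Lbr E u v) = brM i j (act_p u) (act_p v) (Lm u) (Lm v).
Proof.
have [_ hmu hnu _] := hom_L hu; have [hav hmv hnv hxv] := hom_L hv.
rewrite /brM !Endo_addE.
rewrite -[LHS]/(La u *: Lm v + Lx u (Lm v) - Lm u *r La v - sapp (Lm u) (Lx v)).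
rewrite (rscale_hom hav (hmu : hom i (Lm u : M))).
rewrite /sapp (koszulE (@sapp_biadd0 _ _ _) (hmu : hom i (Lm u : M)) hxv).
have -> : La v *: Lm u = (La v)%:I (Lm u) by [].
have -> : La u *: Lm v = (La u)%:I (Lm v) by [].
zmod.
Qed.

Lemma Ln_br : Ln (Lbr E u v) = brM i j (act_m u) (act_m v) (Ln u) (Ln v).
Proof.
have [_ hmu hnu _] := hom_L hu; have [hav hmv hnv hxv] := hom_L hv.
rewrite /brM !Endo_addE !Endo_oppE.
rewrite -[LHS]/(- (La u *: Ln v) + Lx u (Ln v) + Ln u *r La v - sapp (Ln u) (Lx v)).
rewrite (rscale_hom hav (hnu : hom i (Ln u : M))).
rewrite /sapp (koszulE (@sapp_biadd0 _ _ _) (hnu : hom i (Ln u : M)) hxv).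
have -> : La v *: Ln u = (La v)%:I (Ln u) by [].
have -> : La u *: Ln v = (La u)%:I (Ln v) by [].
zmod.
Qed.

Lemma hom_br : hom (i (+) j) (Lbr E u v).
Proof.
have [hau hmu hnu hxu] := hom_L hu; have [hav hmv hnv hxv] := hom_L hv.
apply: hom_mkL.
- by apply: homD; [|apply/homN]; apply: qf_even.
- by move: (hom_brM (hom_act_p hu) hmu (hom_act_p hv) hmv); rewrite -Lm_br.
- by move: (hom_brM (hom_act_m hu) hnu (hom_act_m hv) hnv); rewrite -Ln_br.
- apply/ospS_homE; apply: homD; first by apply: homD; apply: Emn_hom.
  exact: hom_scomm.
Qed.
End Bracket.

(** Both the formulas for the coordinates of a product are skew-symmetric. *)
Lemma br_sym i j u v : hom i u -> hom j v ->
  Lbr E u v = - sg (i && j) (Lbr E v u).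
Proof.
move=> hu hv; rewrite -[- _]/(sg true _); apply: L_eq_coord; rewrite !(act_p_sg, act_m_sg, Lm_sg, Ln_sg).
- rewrite (act_p_br hu hv) (act_p_br hv hu) /brP (scomm_sym (hom_act_p hv) (hom_act_p hu)); zmod.
- rewrite (act_m_br hu hv) (act_m_br hv hu) /brP (scomm_sym (hom_act_m hv) (hom_act_m hu)); zmod.
- rewrite (Lm_br hu hv) (Lm_br hv hu) /brM; zmod.
- rewrite (Ln_br hu hv) (Ln_br hv hu) /brM; zmod.
Qed.

(** S multiplies q(m,n) Id and E_{m,n} by the same Leibniz rule. *)
Lemma compat_S i S : hom i S -> hom_S E S -> compat D i S S.
Proof.
move=> hS [_ [_ S2 _]] j k m n hm hn.
have hSn : hom (i (+) k) (S n) := Endo_hom_app hS hn.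
rewrite /Dq (scomm_biadd _).2 (S2 _ _ _ _ hm hn) (scomm_Emn_S hS hm hn S2).
by rewrite (qf_sym q hSn hm) aIdD !aId_sg; zmod.
Qed.

(** Commuting with T exchanges the two summands of D m n, and the result is the
    Leibniz rule with T on the first and -T on the second argument. *)
Lemma compat_T i T : hom i T -> hom_T E T -> compat D i T (- T).
Proof.
move=> hT [_ [_ T2 _]] j k m n hm hn.
have hTn : hom (i (+) k) (T n) := Endo_hom_app hT hn.
rewrite /Dq (scomm_biadd _).2 (T2 _ _ _ _ hm hn) (scomm_Emn_T hT hm hn T2).
rewrite Endo_oppE -[- T n]/(sg true (T n)).
rewrite (sg_morph (f := q m)); last exact: (qf_biadd q).2.
rewrite (sg_morph (f := Emn q m)); last exact: (Emn_biadd q).2.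
rewrite (Emn_sym q hTn hm) -[- sg _ (q _ _)]/(sg true _) aIdD !aId_sg; zmod.
Qed.

Lemma compatN i U W : compat D i U W -> compat D i (- U) (- W).
Proof.
move=> c j k m n hm hn; rewrite scommNl (c _ _ _ _ hm hn) !Endo_oppE.
rewrite (DNl (Dq_biadd q)) (DNr (Dq_biadd q)); zmod.
Qed.

(** Commutators with A Id vanish, and the condition on q becomes the definition
    of osp(q). *)
Lemma E_hom_S i x : hom i x -> ospS E x -> hom_S E x.
Proof.
move=> hx Ex; have [_ xq] := E_osp Ex.
split; first by exists i.
split=> [a|j k m n hm hn|y Ey].
- rewrite (scomm_E_aId _ hx Ex); exists 0.
  by apply: Endo_eq => m; rewrite /= scale0r.
- rewrite (scomm_E_aId _ hx Ex) (xq _ _ _ _ hm hn).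
  by apply: Endo_eq => p; rewrite /= scale0r.
- by have [_ _] := ospS_subalg E; apply.
Qed.

(** All commutators vanish, and the condition on q becomes the skew-symmetry of
    E_{m,n}. *)
Lemma aId_hom_T i a : hom i a -> hom_T E (a%:I).
Proof.
move=> ha; split; first by exists i; apply: aId_hom.
split=> [b|j k m n hm hn|y Ey].
- by rewrite (scomm_aId2 _ ha); case: (ospS_submod E) => [[]].
- rewrite (scomm_aId2 _ ha).
  apply: Endo_eq => p; rewrite Endo_addE Endo_sgE !Emn_left.
  rewrite (Emn_sym q hn hm) Endo_oppE Endo_sgE !(EndoN, Endo_sgr) Endo_0E; zmod.
- exists 0; have -> : 0%:I = 0 :> Endo V.
    by apply: Endo_eq => m; rewrite /= scale0r.
  have [_ Egr] := ospS_submod E.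
  rewrite -(gr_sum y) (scomm_biadd _).2.
  by rewrite !(scomm_aId_E ha (hom_gr _ _) (Egr _ _ Ey)) addr0.
Qed.

(** The pair of actions of u is the one of S = x and T = a Id. *)
Lemma L_compat i u : hom i u -> compat D i (act_p u) (act_m u) /\ compat D i (act_m u) (act_p u).
Proof.
move=> hu; have [ha _ _ hx] := hom_L hu.
have cx := compat_S hx (E_hom_S hx (ospS_valP _)).
have ca := compat_T (aId_hom M ha) (aId_hom_T ha).
split; first exact: (compatD (Dq_biadd q) ca cx).
by have := compatD (Dq_biadd q) (compatN ca) cx; rewrite opprK.
Qed.

(** Homogeneous derivations with their degree made explicit: zero is homogeneous
    of both degrees, so the degree is not determined by d. *)
Definition der_of (i : bool) (d : Endo L) : Prop :=
  hom i d /\ forall j x y, hom j x ->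
    d (Lbr E x y) = Lbr E (d x) y + sg (i && j) (Lbr E x (d y)).

(** Coordinatewise, the derivation rule is the Jacobi identity for the
    quadruple (U, W, m, n) and two elements of L.  The quadruple need not come
    from L: it may be any derivation (U, W) of the triple product. *)
Lemma der_criterion i (d : Endo L) (U W : Endo V) (m n : V) :
  hom i d -> hom i U -> hom i W -> hom i m -> hom i n ->
  compat D i U W -> compat D i W U ->
  (forall j u, hom j u ->
     [/\ act_p (d u) = brP D i j U (act_p u) m n (Lm u) (Ln u),
         act_m (d u) = brP D i j W (act_m u) n m (Ln u) (Lm u),
         Lm (d u) = brM i j U (act_p u) m (Lm u)
       & Ln (d u) = brM i j W (act_m u) n (Ln u)]) ->
  der_of i d.
Proof.
move=> hd hU hW hm hn cU cW dE; split=> // j x y hx.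
elim/hom_ind: y => [y y' Py Py'|k y hy].
  have brD := ad_additive x; have brD' := ad_additive (d x).
  by rewrite /= brD !EndoD Py Py' brD brD' sgD addrACA.
have hdx := Endo_hom_app hd hx; have hdy := Endo_hom_app hd hy.
have [_ hmx hnx _] := hom_L hx; have [_ hmy hny _] := hom_L hy.
have [px qx mx nx] := dE _ _ hx; have [py qy my ny] := dE _ _ hy.
have [cx cx'] := L_compat hx; have [cy cy'] := L_compat hy.
have [pb qb mb nb] := dE _ _ (hom_br hx hy).
have hpx := hom_act_p hx; have hpy := hom_act_p hy.
have hqx := hom_act_m hx; have hqy := hom_act_m hy.
apply: L_eq_coord.
- rewrite act_pD act_p_sg pb (act_p_br hx hy) (act_p_br hdx hy) (act_p_br hx hdy).
  rewrite (Lm_br hx hy) (Ln_br hx hy) px py mx my nx ny.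
  exact: (jacobiP (Dq_biadd q) (@Dq_hom _ _ _ q)).
- rewrite act_mD act_m_sg qb (act_m_br hx hy) (act_m_br hdx hy) (act_m_br hx hdy).
  rewrite (Lm_br hx hy) (Ln_br hx hy) qx qy mx my nx ny.
  exact: (jacobiP (Dq_biadd q) (@Dq_hom _ _ _ q)).
- rewrite LmD Lm_sg mb (act_p_br hx hy) (Lm_br hdx hy) (Lm_br hx hdy).
  rewrite (Lm_br hx hy) px py mx my.
  exact: (jacobiM (@Dq_swap _ _ _ q)).
- rewrite LnD Ln_sg nb (act_m_br hx hy) (Ln_br hdx hy) (Ln_br hx hdy).
  rewrite (Ln_br hx hy) qx qy nx ny.
  exact: (jacobiM (@Dq_swap _ _ _ q)).
Qed.

End Coordinates.

(** * Derivations and inner derivations of L *)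

Section InnerDerivations.
Variables (K : scRingType) (A : superextType K) (M : supermodType A).
Variables (q : quadform M) (E : ospSubalg q).
Hypothesis half : exists h : K, h *+ 2 = 1.
Hypothesis annM : forall a : A, (forall m : M, a *: m = 0) -> a = 0.
Local Notation L := (Einf E).
Local Notation br := (Lbr E).

Lemma brDr (u v w : L) : br u (v + w) = br u v + br u w.
Proof. exact: (ad_additive u v w). Qed.

Lemma brDl (u v w : L) : br (u + v) w = br u w + br v w.
Proof.
apply: EinfP; rewrite /Lbr /La /Lm /Ln /Lx /=.
- by rewrite !(qf_biadd q).1 opprD addrACA.
- rewrite scalerDl rscaleDl (@sapp_biadd _ _ _).1; zmod.
- rewrite scalerDl rscaleDl (@sapp_biadd _ _ _).1; zmod.
- rewrite !(Emn_biadd q).1 (scomm_biadd _).1; zmod.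
Qed.

Lemma br_sgl b (u v : L) : br (sg b u) v = sg b (br u v).
Proof. exact: (sg_morph (f := fun u => br u v) b _ (fun u w => brDl u w v)). Qed.
Lemma br_sgr b (u v : L) : br u (sg b v) = sg b (br u v).
Proof. exact: (sg_morph (f := br u) b _ (brDr u)). Qed.

(** By skew-symmetry this is the right linearity of the product. *)
Lemma brZl (k : K) (u v : L) : br (k *: u) v = k *: br u v.
Proof.
elim/hom_ind: v => [v w Pv Pw|j v hv]; first by rewrite !brDr Pv Pw scalerDr.
elim/hom_ind: u => [u w Pu Pw|i u hu].
  by rewrite scalerDr !brDl Pu Pw scalerDr.
elim/hom_ind: k => [k l Pk Pl|c k hk]; first by rewrite !scalerDl !brDl Pk Pl.
have kE w e : hom e w -> k *: w = sg (c && e) (w *r k) :> L.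
  by move=> hw; rewrite (rscale_hom hk hw) sgsg addbb.
rewrite (br_sym half annM (grZ hk hu) hv) (kE _ _ hu) br_sgr ad_linear.
rewrite (kE _ _ (hom_br hu hv)) (br_sym half annM hu hv) -[- sg _ (br v u)]/(sg true _).
rewrite sgsg !(sg_morph (f := fun w : L => w *r k)); try exact: rscaleDl.
zmod.
Qed.

Lemma adD u v : ad (u + v) = ad u + ad v :> Endo L.
Proof. by apply: Endo_eq => w; apply: brDl. Qed.
Lemma ad_sg b u : ad (sg b u) = sg b (ad u) :> Endo L.
Proof. exact/(sg_morph (f := @ad _ _ _ q E))/adD. Qed.
Lemma adZ k u : ad (k *: u) = k *: ad u :> Endo L.
Proof. by apply: Endo_eq => w; apply: brZl. Qed.
Lemma hom_ad i (u : L) : hom i u -> hom i (ad u).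
Proof. by move=> hu; apply/Endo_homP => j v; apply: hom_br. Qed.
Lemma ad0 : ad 0 = 0 :> Endo L.
Proof. by apply: (addIr (ad 0)); rewrite -adD !add0r. Qed.

Lemma gr_ad i (u : L) : gr i (ad u) = ad (gr i u).
Proof.
rewrite -{1}(gr_sum u) adD grD !(gr_hom i (hom_ad (hom_gr _ u))).
by case: i; rewrite /= ?addr0 ?add0r.
Qed.

Lemma adL_gsubmod : is_gsubmod (adL E).
Proof.
split=> [|i d [u ->]]; last by exists (gr i u); rewrite gr_ad.
split=> [|d d' [u ->] [v ->]|k d [u ->]].
- by exists 0; rewrite ad0.
- by exists (u + v); rewrite adD.
- by exists (k *: u); rewrite adZ.
Qed.

Lemma der_of0 i : der_of i (0 : Endo L).
Proof.
split; first exact: hom0.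
move=> j x y _; rewrite !Endo_0E.
have z := biadd0l (conj (fun w u v => brDl u v w) brDr).
by rewrite z (biadd0r (conj (fun w u v => brDl u v w) brDr)) sg0 addr0.
Qed.

Lemma der_ofD i (d d' : Endo L) : der_of i d -> der_of i d' -> der_of i (d + d').
Proof.
move=> [hd dd] [hd' dd']; split; first exact: homD.
move=> j x y hx; rewrite !Endo_addE (dd _ _ _ hx) (dd' _ _ _ hx) brDl brDr.
zmod.
Qed.

Lemma der_ofZ i j k (d : Endo L) : hom j k -> der_of i d -> der_of (j (+) i) (k *: d).
Proof.
move=> hk [hd dd]; split; first exact: grZ.
move=> l x y hx; rewrite !Endo_scaleE (dd _ _ _ hx) scalerDr brZl.
have -> : br x (k *: d y) = sg (l && j) (k *: br x (d y)).
  exact: (Endo_scale_hom (d y) (hom_ad hx) hk).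
rewrite scale_sgr sgsg; congr (_ + sg _ _).
by case: (i) (j) (l) => [] [] [].
Qed.

Lemma hom_derP (d : Endo L) : hom_der br d <-> exists i, der_of i d.
Proof. by split=> [[i hd dd]|[i [hd dd]]]; exists i. Qed.

(** If d has two different degrees then d = 0. *)
Lemma der_of_hom i j (d : Endo L) : der_of i d -> hom j d -> der_of j d.
Proof.
move=> di hj; have e : d = if i == j then d else 0.
  by rewrite -(gr_hom i hj); symmetry; apply: di.1.
by move: e; case: eqP => [<- _ //|_ ->]; apply: der_of0.
Qed.

Lemma Der_gr i (d : Endo L) : Der br d -> der_of i (gr i d).
Proof.
move=> Dd.
have /hom_derP[j dj] : hom_der br (gr i d).
  apply: kspan_gr Dd => [d'|||]; last first.
  - move=> j k d' hk /hom_derP[l ld]; apply/hom_derP; exists (j (+) l).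
    exact: der_ofZ.
  - move=> j d1 d2 h1 h2 /hom_derP[k1 dk1] /hom_derP[k2 dk2]; apply/hom_derP.
    by exists j; apply: der_ofD; [apply: der_of_hom dk1 h1|apply: der_of_hom dk2 h2].
  - by apply/hom_derP; exists false; apply: der_of0.
  - by move=> /hom_derP[j [hd _]]; exists j.
exact: der_of_hom dj (hom_gr _ _).
Qed.

Lemma der_of_Der i (d : Endo L) : der_of i d -> Der br d.
Proof. by move=> dd; apply: kspan_sub; apply/hom_derP; exists i. Qed.

Lemma Der_gsubmod : is_gsubmod (Der br).
Proof. by apply: kspan_gsubmod => d /hom_derP[i [hd _]]; exists i. Qed.

Lemma gr_ind (W : superZmodType) (N : set W) (w : W) :
  (forall u v, N u -> N v -> N (u + v)) -> (forall i, N (gr i w)) -> N w.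
Proof. by move=> ND Nw; rewrite -(gr_sum w); apply: ND. Qed.

(** Reduces closure under commutators to homogeneous arguments. *)
Lemma scomm_gr_ind (W : supermodType K) (N : set (Endo W)) (f g : Endo W) :
  (forall u v, N u -> N v -> N (u + v)) ->
  (forall i j, N (scomm (gr i f) (gr j g))) -> N (scomm f g).
Proof.
move=> ND Nfg; rewrite -(gr_sum f) -(gr_sum g).
by rewrite (scomm_biadd _).1 !(scomm_biadd _).2; apply: (ND); apply: (ND).
Qed.

Lemma der_of_scomm i j (d d' : Endo L) :
  der_of i d -> der_of j d' -> der_of (i (+) j) (scomm d d').
Proof.
move=> [hd dd] [hd' dd']; split; first exact: hom_scomm.
move=> k x y hx; rewrite !(scommE _ hd hd') (dd _ _ _ hx) (dd' _ _ _ hx).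
rewrite !EndoD !Endo_sgr (dd _ _ _ hx) (dd' _ _ _ hx).
rewrite (dd _ _ _ (Endo_hom_app hd' hx)) (dd' _ _ _ (Endo_hom_app hd hx)).
rewrite -![- _]/(sg true _) !(brDl, brDr, br_sgl, br_sgr); zmod.
Qed.

Lemma Der_scomm d d' : Der br d -> Der br d' -> Der br (scomm d d').
Proof.
have [[_ DD _] _] := Der_gsubmod => Dd Dd'; apply: scomm_gr_ind => // i j.
exact: (der_of_Der (der_of_scomm (Der_gr i Dd) (Der_gr j Dd'))).
Qed.

(** This is the Jacobi identity of L: the quadruple is the one of u itself. *)
Lemma der_of_ad i (u : L) : hom i u -> der_of i (ad u).
Proof.
move=> hu; have [cu cu'] := L_compat hu; have [_ hm hn _] := hom_L hu.
apply: (der_criterion half annM (hom_ad hu) (hom_act_p hu) (hom_act_m hu) hm hn) => //.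
by move=> j v hv; split; [exact: act_p_br|exact: act_m_br|exact: Lm_br|exact: Ln_br].
Qed.

Lemma adL_Der : adL E `<=` Der br.
Proof.
have [[_ DD _] _] := Der_gsubmod => d [u ->].
apply: gr_ind => // i; rewrite gr_ad.
exact: (der_of_Der (der_of_ad (hom_gr i u))).
Qed.

Lemma scomm_ad i j (d : Endo L) (u : L) : der_of i d -> hom j u ->
  scomm d (ad u) = ad (d u).
Proof.
move=> [hd dd] hu; apply: Endo_eq => v.
by rewrite (scommE _ hd (hom_ad hu)) /= (dd _ _ _ hu) addrK.
Qed.

Lemma adL_ideal : is_ideal (@scomm K L) (Der br) (adL E).
Proof.
have [[a0 aD aZ] aG] := adL_gsubmod; split; [exact: adL_Der|exact: adL_gsubmod|].
move=> d _ Dd [u ->].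
have H i j : scomm (gr i d) (gr j (ad u)) = ad (gr i d (gr j u)).
  by rewrite gr_ad (scomm_ad (Der_gr i Dd) (hom_gr _ _)).
split; apply: scomm_gr_ind => // i j; first by rewrite H; eexists.
rewrite (scomm_sym (hom_gr _ _) (hom_gr _ _)) H -[- _]/(sg true _) -!ad_sg.
by eexists.
Qed.

End InnerDerivations.

(** * The decomposition of L and the maps d_{S,T} *)

Section HomogeneousParts.
Variables (K : scRingType) (A : superextType K) (M : supermodType A).
Variables (q : quadform M) (E : ospSubalg q).
Hypothesis half : exists h : K, h *+ 2 = 1.
Hypothesis annM : forall a : A, (forall m : M, a *: m = 0) -> a = 0.
Local Notation V := (resK M).
Local Notation "a %:I" := (aId M a) (at level 2, format "a %:I").
Local Notation L := (Einf E).
Local Notation br := (Lbr E).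

Definition in_plus (m : V) : L := mkL 0 m 0 0.
Definition in_minus (n : V) : L := mkL 0 0 n 0.
Definition in_zero (a : A) (x : ospS_type E) : L := mkL a 0 0 x.

Lemma L_decomp (u : L) : u = in_zero (La u) (Lx u) + in_plus (Lm u) + in_minus (Ln u).
Proof.
by apply: EinfP; rewrite /La /Lm /Ln /Lx /= ?addr0 ?add0r.
Qed.

Lemma aId0 : 0%:I = 0 :> Endo V.
Proof. by apply: Endo_eq => m; rewrite /= scale0r. Qed.

Lemma act_p_in_plus m : act_p (in_plus m) = 0. Proof. by rewrite /act_p /= aId0 addr0. Qed.
Lemma act_m_in_plus m : act_m (in_plus m) = 0. Proof. by rewrite /act_m /= aId0 oppr0 addr0. Qed.
Lemma act_p_in_minus m : act_p (in_minus m) = 0. Proof. by rewrite /act_p /= aId0 addr0. Qed.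
Lemma act_m_in_minus m : act_m (in_minus m) = 0. Proof. by rewrite /act_m /= aId0 oppr0 addr0. Qed.

Lemma hom_in_plus i m : hom i m -> hom i (in_plus m).
Proof. by move=> hm; apply: hom_mkL => //; apply: hom0. Qed.
Lemma hom_in_minus i m : hom i m -> hom i (in_minus m).
Proof. by move=> hm; apply: hom_mkL => //; apply: hom0. Qed.
Lemma hom_in_zero i (u : L) : hom i u -> hom i (in_zero (La u) (Lx u)).
Proof.
by move=> /hom_L[ha _ _ hx]; apply: hom_mkL; rewrite ?ospS_homE //; apply: hom0.
Qed.

Lemma LzeroP (u : L) : Lzero u <-> Lm u = 0 /\ Ln u = 0.
Proof.
split=> [[a [x ->]] //|[hm hn]]; exists (La u), (Lx u).
by rewrite {1}(L_decomp u) hm hn; apply: EinfP; rewrite /La /Lm /Ln /Lx /= ?addr0.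
Qed.

Lemma act_p_eq0 (u : L) : act_p u = 0 -> act_m u = 0 -> La u = 0 /\ Lx u = 0 :> ospS_type E.
Proof.
move=> p0 q0; have e : u = in_plus (Lm u) + in_minus (Ln u).
  apply: (L_eq_coord half annM).
  - by rewrite act_pD act_p_in_plus act_p_in_minus p0 addr0.
  - by rewrite act_mD act_m_in_plus act_m_in_minus q0 addr0.
  - by rewrite LmD /= addr0.
  - by rewrite LnD /= add0r.
by rewrite e; split; rewrite /La /Lx /= addr0.
Qed.

Lemma LplusP (u : L) : Lplus u <-> [/\ act_p u = 0, act_m u = 0 & Ln u = 0].
Proof.
split=> [[m ->]|[hp hq hn]]; first by rewrite -[mkL _ _ _ _]/(in_plus m) act_p_in_plus act_m_in_plus.
exists (Lm u); have [ea ex] := act_p_eq0 hp hq.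
by apply: EinfP; rewrite ?ea ?hn // ex.
Qed.

Lemma LminusP (u : L) : Lminus u <-> [/\ act_p u = 0, act_m u = 0 & Lm u = 0].
Proof.
split=> [[m ->]|[hp hq hn]]; first by rewrite -[mkL _ _ _ _]/(in_minus m) act_p_in_minus act_m_in_minus.
exists (Ln u); have [ea ex] := act_p_eq0 hp hq.
by apply: EinfP; rewrite ?ea ?hn // ex.
Qed.

Section BracketValues.
Variables (i j : bool) (u : L) (m : V).
Hypothesis hu : hom i u.

Lemma br_in_plus : hom j m -> Lm u = 0 -> Ln u = 0 -> br u (in_plus m) = in_plus (act_p u m).
Proof.
move=> hm um un; have hv := hom_in_plus hm.
have s0 := biadd0r (@scomm_biadd K V).
have Dl := biadd0l (Dq_biadd q); have Dr := biadd0r (Dq_biadd q).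
apply: (L_eq_coord half annM).
- by rewrite (act_p_br hu hv) !act_p_in_plus /brP s0 um un Dl Dr sg0 subr0 addr0.
- by rewrite (act_m_br hu hv) !act_m_in_plus /brP s0 um un Dl Dr sg0 subr0 addr0.
- by rewrite (Lm_br hu hv) act_p_in_plus /brM um /= sg0 subr0.
- by rewrite (Ln_br hu hv) act_m_in_plus /brM un !Endo0 sg0 subr0.
Qed.

Lemma br_in_minus : hom j m -> Lm u = 0 -> Ln u = 0 -> br u (in_minus m) = in_minus (act_m u m).
Proof.
move=> hm um un; have hv := hom_in_minus hm.
have s0 := biadd0r (@scomm_biadd K V).
have Dl := biadd0l (Dq_biadd q); have Dr := biadd0r (Dq_biadd q).
apply: (L_eq_coord half annM).
- by rewrite (act_p_br hu hv) !act_p_in_minus /brP s0 um un Dl Dr sg0 subr0 addr0.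
- by rewrite (act_m_br hu hv) !act_m_in_minus /brP s0 um un Dl Dr sg0 subr0 addr0.
- by rewrite (Lm_br hu hv) act_p_in_minus /brM um !Endo0 sg0 subr0.
- by rewrite (Ln_br hu hv) act_m_in_minus /brM un /= sg0 subr0.
Qed.
End BracketValues.

Lemma br_in_plus_in_minus m n : br (in_plus m) (in_minus n) = in_zero (q m n) (toE (Emn_in E m n)).
Proof.
apply: EinfP; rewrite /Lbr /La /Lm /Ln /Lx /=.
- by rewrite (biadd0l (qf_biadd q)) subr0.
- have z : (m : M) *r (0 : A) = 0.
    by apply: (addIr ((m : M) *r (0 : A))); rewrite -rscaleDr !add0r.
  rewrite -[LHS]/((0 : A) *: (0 : M) + 0 - (m : M) *r (0 : A) - sapp m 0).
  by rewrite z (biadd0r (@sapp_biadd _ _ _)) scaler0; zmod.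
- have z : (0 : M) *r (0 : A) = 0.
    by apply: (addIr ((0 : M) *r (0 : A))); rewrite -rscaleDr !add0r.
  rewrite -[LHS]/(- ((0 : A) *: (n : M)) + 0 + (0 : M) *r (0 : A) - sapp (0 : M) 0).
  by rewrite z (biadd0l (@sapp_biadd _ _ _)) scale0r; zmod.
- by rewrite (biadd0l (Emn_biadd q)) (biadd0l (@scomm_biadd _ _)) !addr0.
Qed.

(** In the coordinates of L, the map d_{S,T} is the commutator with S + T and
    S - T on the operators, and their action on L_+ and L_-. *)
Lemma is_dSTP S T (d : Endo L) : is_dST S T d <->
  forall u, [/\ act_p (d u) = scomm (S + T) (act_p u), act_m (d u) = scomm (S - T) (act_m u),
     Lm (d u) = (S + T) (Lm u) & Ln (d u) = (S - T) (Ln u)].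
Proof.
split=> [dP [[[a m] n] x]|dP a m n x].
  have [ea em en ex] := dP a m n x; rewrite -[(a, m, n, x)]/(mkL a m n x); split=> //.
  - rewrite /act_p ea ex !((scomm_biadd _).1, (scomm_biadd _).2) /La /Lx /=; zmod.
  - rewrite /act_m ea ex !((scomm_biadd _).1, (scomm_biadd _).2, scommNl, scommNr).
    rewrite /La /Lx /=; zmod.
move=> w; have [ep eq em en] := dP (mkL a m n x); rewrite -/w in ep eq em en.
split=> //; apply: (dbl_inj half).
- have -> : (La w)%:I + (La w)%:I = act_p w - act_m w by rewrite /act_p /act_m; zmod.
  rewrite ep eq /act_p /act_m !((scomm_biadd _).1, (scomm_biadd _).2, scommNl, scommNr).
  rewrite /La /Lx /=; zmod.
- have -> : (Lx w : Endo V) + Lx w = act_p w + act_m w by rewrite /act_p /act_m; zmod.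
  rewrite ep eq /act_p /act_m !((scomm_biadd _).1, (scomm_biadd _).2, scommNl, scommNr).
  rewrite /La /Lx /=; zmod.
Qed.

Lemma is_dST_on_hom S T (d : Endo L) :
  (forall j u, hom j u ->
     [/\ act_p (d u) = scomm (S + T) (act_p u), act_m (d u) = scomm (S - T) (act_m u),
     Lm (d u) = (S + T) (Lm u) & Ln (d u) = (S - T) (Ln u)]) -> is_dST S T d.
Proof.
move=> H; apply/is_dSTP; move: (S + T) (S - T) H => U W H.
have cr := (@scomm_biadd K V).2.
elim/hom_ind => [u v [a1 a2 a3 a4] [b1 b2 b3 b4]|//].
rewrite EndoD !act_pD !act_mD !LmD !LnD a1 a2 a3 a4 b1 b2 b3 b4.
split; symmetry; [exact: cr|exact: cr|exact: (EndoD U)|exact: (EndoD W)].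
Qed.

(** The restrictions of d to L_+ and L_- are S + T and S - T. *)
Lemma is_dST_inj S T S' T' (d : Endo L) :
  is_dST S T d -> is_dST S' T' d -> S = S' /\ T = T'.
Proof.
move=> /is_dSTP h /is_dSTP h'.
have eP : S + T = S' + T'.
  apply: Endo_eq => m; have [_ _ e _] := h (in_plus m); have [_ _ e' _] := h' (in_plus m).
  by move: e; rewrite e'.
have eN : S - T = S' - T'.
  apply: Endo_eq => m; have [_ _ _ e] := h (in_minus m); have [_ _ _ e'] := h' (in_minus m).
  by move: e; rewrite e'.
have eS : S = S'.
  apply: (dbl_inj half).
  have -> : S + S = (S + T) + (S - T) by zmod.
  by rewrite eP eN; zmod.
by split=> //; apply: (addrI S); rewrite eP eS.
Qed.

Lemma is_dSTD S T S' T' (d d' : Endo L) :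
  is_dST S T d -> is_dST S' T' d' -> is_dST (S + S') (T + T') (d + d').
Proof.
move=> /is_dSTP h /is_dSTP h'; apply/is_dSTP => u.
have [e1 e2 e3 e4] := h u; have [f1 f2 f3 f4] := h' u.
have eP : S + S' + (T + T') = (S + T) + (S' + T') by apply: addrACA.
have eN : S + S' - (T + T') = (S - T) + (S' - T') by rewrite opprD; apply: addrACA.
rewrite Endo_addE act_pD act_mD LmD LnD e1 e2 e3 e4 f1 f2 f3 f4 eP eN.
by rewrite !(scomm_biadd _).1; split.
Qed.

Lemma act_pZ (k : K) (u : L) : act_p (k *: u) = k *: act_p u.
Proof.
by rewrite /act_p scalerDr aId_scale; congr (_%:I + _).
Qed.
Lemma act_mZ (k : K) (u : L) : act_m (k *: u) = k *: act_m u.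
Proof.
by rewrite /act_m scalerDr scalerN aId_scale; congr (- _%:I + _).
Qed.

Lemma is_dSTZ (k : K) S T (d : Endo L) :
  is_dST S T d -> is_dST (k *: S) (k *: T) (k *: d).
Proof.
move=> /is_dSTP h; apply/is_dSTP => u; have [e1 e2 e3 e4] := h u.
rewrite Endo_scaleE act_pZ act_mZ -scalerBr -scalerDr !scomm_scale e1 e2; split=> //.
- by rewrite [LHS]/(k *: (Lm (d u) : V)) e3.
- by rewrite [LHS]/(k *: (Ln (d u) : V)) e4.
Qed.

Lemma gr_aId i a : gr i (a%:I) = (gr i a)%:I :> Endo V.
Proof.
rewrite -{1}(gr_sum a) aIdD grD !(gr_hom i (aId_hom M (hom_gr _ a))).
by case: i; rewrite /= ?addr0 ?add0r.
Qed.

Lemma aId_homP i a : hom i (a%:I : Endo V) -> hom i a.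
Proof. by rewrite /hom gr_aId; apply: aId_inj. Qed.

Lemma is_dST_hom i S T (d : Endo L) :
  hom i S -> hom i T -> is_dST S T d -> hom i d.
Proof.
move=> hS hT dP; apply/Endo_homP => j [[[a m] n] x] hu.
have [ea em en ex] := dP a m n x; have [ha hm hn hx] := hom_L hu.
have haI := aId_hom M ha.
rewrite [d _](L_decomp (d (a, m, n, x))); apply: homD; first apply: homD.
- apply: hom_mkL; try exact: hom0.
    by apply: aId_homP; rewrite ea; apply: homD; apply: hom_scomm.
  by apply/ospS_homE; rewrite ex; apply: homD; apply: hom_scomm.
- by apply: hom_in_plus; rewrite em; apply: Endo_hom_app => //; apply: homD.
- by apply: hom_in_minus; rewrite en; apply: Endo_hom_app => //; apply/homD => //; apply: homN.
Qed.

End HomogeneousParts.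

(** * Endomorphisms that preserve a submodule *)

Section Stable.
Variables (K : scRingType) (W : supermodType K) (N : set W).
Hypothesis gN : is_gsubmod N.

Definition stable (f : Endo W) : Prop := forall u, N u -> N (f u).

Lemma submod_sg b u : N u -> N (sg b u).
Proof.
have [[_ _ NZ] _] := gN => Nu; case: b => //=.
by rewrite -scaleN1r; apply: NZ.
Qed.

Lemma stable_gsubmod : is_gsubmod stable.
Proof.
have [[N0 ND NZ] NG] := gN; split; first split.
- by move=> u _.
- by move=> f g sf sg u Nu; apply: ND; [apply: sf|apply: sg].
- by move=> k f sf u Nu; apply/NZ/sf.
- move=> i f sf u Nu; rewrite /= big_bool; apply: ND; exact/NG/sf/NG.
Qed.

Lemma stable_scomm f g : stable f -> stable g -> stable (scomm f g).
Proof.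
have [[N0 ND NZ] NG] := gN; have [[_ sD _] sG] := stable_gsubmod.
move=> hf hg; apply: scomm_gr_ind => // i j u Nu.
rewrite (scommE _ (hom_gr _ _) (hom_gr _ _)) -[- _]/(sg true _).
by apply: (ND); do ?apply: submod_sg; apply: (sG) => //; apply: (sG).
Qed.
End Stable.

(** * The maps d_{S,T} are derivations of degree zero *)

Section StructureMaps.
Variables (K : scRingType) (A : superextType K) (M : supermodType A).
Variables (q : quadform M) (E : ospSubalg q).
Hypothesis half : exists h : K, h *+ 2 = 1.
Hypothesis annM : forall a : A, (forall m : M, a *: m = 0) -> a = 0.
Local Notation V := (resK M).
Local Notation "a %:I" := (aId M a) (at level 2, format "a %:I").
Local Notation L := (Einf E).
Local Notation D := (Dq q).

Lemma q_Z (k : K) (m : V) (n : M) : q (k *: m) n = kscale k 1 * q m n.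
Proof. exact: q_left. Qed.

Lemma Emn_Z (k : K) (m n : V) : Emn q (k *: m) n = k *: Emn q m n.
Proof. by apply: Endo_eq => p; apply: Emn_left. Qed.

(** The conditions on S are additive in S and compatible with scalars. *)
Lemma SE_gr i S : SE E S -> hom_S E (gr i S).
Proof.
have [a0 aD aZ] := AId_submod M; have [[e0 eD eZ] _] := ospS_submod E.
have [ql qr] := qf_biadd q; have [cl cr] := @scomm_biadd K V.
move=> hS; apply: kspan_gr hS => {i S} [S [] //||i S T hS hT [_ [S1 S2 S3]] [_ [T1 T2 T3]]|i k S hk].
- split; first by exists false; apply: hom0.
  split=> [a|i j m n _ _|x _]; rewrite (biadd0l (@scomm_biadd K V)) //.
  by rewrite !(biadd0l (qf_biadd q)) sg0 addr0 aId0.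
- split; first by exists i; apply: homD.
  split=> [a|j k m n hm hn|x Ex]; rewrite cl; first exact: aD.
    rewrite (S2 _ _ _ _ hm hn) (T2 _ _ _ _ hm hn) -aIdD !Endo_addE !ql; congr (_%:I).
    zmod.
  by apply: eD; [apply: S3|apply: T3].
- move=> [[j hS] [S1 S2 S3]]; split; first by exists (i (+) j); apply: grZ.
  split=> [a|l l' m n hm hn|x Ex]; rewrite scomm_scale; first exact: aZ.
    rewrite (S2 _ _ _ _ hm hn) aId_scale !Endo_scaleE !q_Z mulrDr; congr (_ + _)%:I.
    by case: (l && l'); rewrite //= mulrN.
  by apply/eZ/S3.
Qed.

Lemma TE_gr i T : TE E T -> hom_T E (gr i T).
Proof.
have [a0 aD aZ] := AId_submod M; have [[e0 eD eZ] _] := ospS_submod E.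
have [ql qr] := Emn_biadd q; have [cl cr] := @scomm_biadd K V.
move=> hS; apply: kspan_gr hS => {i T} [S [] //||i S T hS hT [_ [S1 S2 S3]] [_ [T1 T2 T3]]|i k S hk].
- split; first by exists false; apply: hom0.
  split=> [a|i j m n _ _|x _]; rewrite (biadd0l (@scomm_biadd K V)) //.
  by rewrite !(biadd0l (Emn_biadd q)) sg0 addr0.
- split; first by exists i; apply: homD.
  split=> [a|j k m n hm hn|x Ex]; rewrite cl; first by apply: eD.
    rewrite (S2 _ _ _ _ hm hn) (T2 _ _ _ _ hm hn) !Endo_addE !ql.
    zmod.
  by apply: aD; [apply: S3|apply: T3].
- move=> [[j hS] [S1 S2 S3]]; split; first by exists (i (+) j); apply: grZ.
  split=> [a|l l' m n hm hn|x Ex]; rewrite scomm_scale; first by apply: eZ.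
    by rewrite (S2 _ _ _ _ hm hn) !Endo_scaleE !Emn_Z scalerDr scale_sgr.
  by apply/aZ/S3.
Qed.

Lemma SE_gsubmod : is_gsubmod (SE E).
Proof. by apply: kspan_gsubmod => S []. Qed.
Lemma TE_gsubmod : is_gsubmod (TE E).
Proof. by apply: kspan_gsubmod => T []. Qed.

Lemma dST_eq S T d : SE E S -> TE E T -> is_dST S T d -> dST E S T = d.
Proof. by move=> hS hT; apply: (dST_unique annM); apply: dSTP. Qed.

Lemma dST_D S T S' T' : SE E S -> TE E T -> SE E S' -> TE E T' ->
  dST E (S + S') (T + T') = dST E S T + dST E S' T'.
Proof.
move=> hS hT hS' hT'; have [[_ sD _] _] := SE_gsubmod.
have [[_ tD _] _] := TE_gsubmod.
by apply: dST_eq; [apply: sD|apply: tD|apply: is_dSTD => //; apply: (dSTP annM)].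
Qed.

Lemma dST_Z k S T : SE E S -> TE E T ->
  dST E (k *: S) (k *: T) = k *: dST E S T.
Proof.
move=> hS hT; have [[_ _ sZ] _] := SE_gsubmod.
have [[_ _ tZ] _] := TE_gsubmod.
by apply: dST_eq; [apply: sZ|apply: tZ|apply: is_dSTZ => //; apply: (dSTP annM)].
Qed.

Lemma dST_gr i S T : SE E S -> TE E T ->
  dST E (gr i S) (gr i T) = gr i (dST E S T).
Proof.
move=> hS hT; have [_ sG] := SE_gsubmod; have [_ tG] := TE_gsubmod.
rewrite -{2}(gr_sum S) -{2}(gr_sum T) dST_D; try by [apply: sG|apply: tG].
have h j : hom j (dST E (gr j S) (gr j T)).
  apply: (is_dST_hom annM (hom_gr j S) (hom_gr j T)).
  by apply: (dSTP annM); [apply: sG|apply: tG].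
by rewrite grD !(gr_hom i (h _)); case: i; rewrite /= ?addr0 ?add0r.
Qed.

Lemma brP0 i j U P m n : brP D i j U P 0 0 m n = scomm U P.
Proof.
by rewrite /brP (biadd0l (Dq_biadd q)) (biadd0r (Dq_biadd q)) sg0 subr0 addr0.
Qed.

Lemma brM0 i j (U P : Endo V) m : brM i j U P 0 m = U m.
Proof. by rewrite /brM Endo0 sg0 subr0. Qed.

(** The operators S + T and S - T form a derivation of the triple product. *)
Lemma dST_der_of i S T (d : Endo L) : hom i S -> hom i T -> hom_S E S -> hom_T E T ->
  is_dST S T d -> der_of i d.
Proof.
move=> hS hT sS tT dP; have hd := is_dST_hom annM hS hT dP.
have cS := compat_S hS sS; have cT := compat_T hT tT.
apply: (@der_criterion _ _ _ _ _ half annM _ _ (S + T) (S - T) 0 0) => //.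
- exact: homD.
- by apply: homD => //; apply: homN.
- exact: hom0.
- exact: hom0.
- exact: (compatD (Dq_biadd q) cS cT).
- by have := compatD (Dq_biadd q) cS (compatN cT); rewrite opprK.
move=> j u _; have [] := (is_dSTP half S T d).1 dP u.
by rewrite !brP0 !brM0.
Qed.

Lemma gr_act_p i (u : L) : act_p (gr i u) = gr i (act_p u).
Proof. by rewrite grD gr_aId. Qed.
Lemma gr_act_m i (u : L) : act_m (gr i u) = gr i (act_m u).
Proof. by rewrite grD grN gr_aId. Qed.

Lemma Lzero_gsubmod : is_gsubmod (@Lzero K A M q E).
Proof.
split; first split; first by apply/LzeroP.
- move=> u v /LzeroP[a b] /LzeroP[c d]; apply/LzeroP.
  by rewrite LmD LnD a b c d addr0.
- move=> k u /LzeroP[a b]; apply/LzeroP; split.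
    by rewrite [LHS]/(k *: (Lm u : V)) a; apply: (@scaler0 K V).
  by rewrite [LHS]/(k *: (Ln u : V)) b; apply: (@scaler0 K V).
- move=> i u /LzeroP[a b]; apply/LzeroP; split.
    by rewrite [LHS]/(gr i (Lm u)) a; apply: (@gr0 V).
  by rewrite [LHS]/(gr i (Ln u)) b; apply: (@gr0 V).
Qed.

Lemma act_p0 : act_p (0 : L) = 0.
Proof. by rewrite -(scale0r (0 : L)) act_pZ scale0r. Qed.
Lemma act_m0 : act_m (0 : L) = 0.
Proof. by rewrite -(scale0r (0 : L)) act_mZ scale0r. Qed.

Lemma Lplus_gsubmod : is_gsubmod (@Lplus K A M q E).
Proof.
split; first split; first by exists 0.
- move=> u v /(LplusP half annM)[a b e] /(LplusP half annM)[c d f].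
  by apply/(LplusP half annM); rewrite act_pD act_mD LnD a b c d e f !addr0.
- move=> k u /(LplusP half annM)[a b e]; apply/(LplusP half annM).
  by rewrite act_pZ act_mZ [Ln _]/(k *: (Ln u : V)) a b e !scaler0; split=> //; apply: (@scaler0 K V).
- move=> i u /(LplusP half annM)[a b e]; apply/(LplusP half annM).
  by rewrite gr_act_p gr_act_m [Ln _]/(gr i (Ln u)) a b e !gr0; split=> //; apply: (@gr0 V).
Qed.

Lemma Lminus_gsubmod : is_gsubmod (@Lminus K A M q E).
Proof.
split; first split; first by exists 0.
- move=> u v /(LminusP half annM)[a b e] /(LminusP half annM)[c d f].
  by apply/(LminusP half annM); rewrite act_pD act_mD LmD a b c d e f !addr0.
- move=> k u /(LminusP half annM)[a b e]; apply/(LminusP half annM).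
  by rewrite act_pZ act_mZ [Lm _]/(k *: (Lm u : V)) a b e !scaler0; split=> //; apply: (@scaler0 K V).
- move=> i u /(LminusP half annM)[a b e]; apply/(LminusP half annM).
  by rewrite gr_act_p gr_act_m [Lm _]/(gr i (Lm u)) a b e !gr0; split=> //; apply: (@gr0 V).
Qed.

Lemma Der0_gsubmod : is_gsubmod (Der0 E).
Proof.
have [[D0 DD DZ] DG] := Der_gsubmod E.
have [[z0 zD zZ] zG] := stable_gsubmod Lzero_gsubmod.
have [[p0 pD pZ] pG] := stable_gsubmod Lplus_gsubmod.
have [[m0 mD mZ] mG] := stable_gsubmod Lminus_gsubmod.
split; first split; first by [].
- move=> f g [? ? ? ?] [? ? ? ?].
  by split; [apply: DD|apply: zD|apply: pD|apply: mD].
- by move=> k f [? ? ? ?]; split; [apply: DZ|apply: zZ|apply: pZ|apply: mZ].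
- by move=> i f [? ? ? ?]; split; [apply: DG|apply: zG|apply: pG|apply: mG].
Qed.

Lemma Der0_scomm d d' : Der0 E d -> Der0 E d' -> Der0 E (scomm d d').
Proof.
move=> [? ? ? ?] [? ? ? ?]; split; first exact: Der_scomm.
- exact: (stable_scomm Lzero_gsubmod).
- exact: (stable_scomm Lplus_gsubmod).
- exact: (stable_scomm Lminus_gsubmod).
Qed.

Lemma DM_Der0 : DM E `<=` Der0 E.
Proof.
move=> d [S [T [hS hT ->]]]; have [_ sG] := SE_gsubmod; have [_ tG] := TE_gsubmod.
have [[_ DD _] _] := Der_gsubmod E.
have dP := (is_dSTP half _ _ _).1 (dSTP annM hS hT).
split=> [|u|u|u].
- apply: gr_ind => // i; rewrite -dST_gr //.
  apply: (@der_of_Der _ _ _ _ _ i).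
  apply: (dST_der_of (hom_gr i S) (hom_gr i T) (SE_gr i hS) (TE_gr i hT)).
  by apply: (dSTP annM); [apply: sG|apply: tG].
- move=> /LzeroP[a b]; apply/LzeroP; have [_ _ -> ->] := dP u.
  by rewrite a b !Endo0.
- move=> /(LplusP half annM)[a b c]; apply/(LplusP half annM); have [-> -> _ ->] := dP u.
  by rewrite a b c !(biadd0r (@scomm_biadd _ _)) !Endo0.
- move=> /(LminusP half annM)[a b c]; apply/(LminusP half annM); have [-> -> -> _] := dP u.
  by rewrite a b c !(biadd0r (@scomm_biadd _ _)) !Endo0.
Qed.

End StructureMaps.

(** * Derivations of degree zero are maps d_{S,T} *)

Section GradedDerivations.
Variables (K : scRingType) (A : superextType K) (M : supermodType A).
Variables (q : quadform M) (E : ospSubalg q).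
Hypothesis half : exists h : K, h *+ 2 = 1.
Hypothesis annM : forall a : A, (forall m : M, a *: m = 0) -> a = 0.
Local Notation V := (resK M).
Local Notation "a %:I" := (aId M a) (at level 2, format "a %:I").
Local Notation L := (Einf E).
Local Notation in_plus := (in_plus E).
Local Notation in_minus := (in_minus E).

Lemma in_plusD m n : in_plus (m + n) = in_plus m + in_plus n.
Proof. by apply: EinfP; rewrite /La /Lm /Ln /Lx /= ?addr0. Qed.
Lemma in_minusD m n : in_minus (m + n) = in_minus m + in_minus n.
Proof. by apply: EinfP; rewrite /La /Lm /Ln /Lx /= ?addr0. Qed.

Lemma in_plus_rscale (m : V) (k : K) : in_plus (m *r k) = in_plus m *r k.
Proof.
rewrite Einf_rscale; apply: EinfP; rewrite /La /Lm /Ln /Lx /=.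
- by rewrite mul0r.
- exact: resK_rscaleE.
- by rewrite rscale0.
- by rewrite rscale0.
Qed.

Lemma in_minus_rscale (m : V) (k : K) : in_minus (m *r k) = in_minus m *r k.
Proof.
rewrite Einf_rscale; apply: EinfP; rewrite /La /Lm /Ln /Lx /=.
- by rewrite mul0r.
- by rewrite rscale0.
- exact: resK_rscaleE.
- by rewrite rscale0.
Qed.

Lemma Lm_rscale (u : L) (k : K) : Lm (u *r k) = (Lm u : V) *r k.
Proof. by rewrite Einf_rscale resK_rscaleE. Qed.
Lemma Ln_rscale (u : L) (k : K) : Ln (u *r k) = (Ln u : V) *r k.
Proof. by rewrite Einf_rscale resK_rscaleE. Qed.

#[local] Obligation Tactic := idtac.

(** For d preserving L_+ this is the restriction of d to L_+; the projection
    makes it an endomorphism for every d. *)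
Program Definition plus_part (d : Endo L) : Endo V :=
  @MkEndo K V (fun m => Lm (d (in_plus m))) _ _.
Next Obligation. by move=> d u v; rewrite /= in_plusD EndoD. Qed.
Next Obligation. by move=> d v k; rewrite /= in_plus_rscale EndoZ Lm_rscale. Qed.

Program Definition minus_part (d : Endo L) : Endo V :=
  @MkEndo K V (fun n => Ln (d (in_minus n))) _ _.
Next Obligation. by move=> d u v; rewrite /= in_minusD EndoD. Qed.
Next Obligation. by move=> d v k; rewrite /= in_minus_rscale EndoZ Ln_rscale. Qed.

Section HomDer0.
Variables (i : bool) (d : Endo L).
Hypothesis (dd : der_of i d) (dz : stable (@Lzero _ _ _ _ E) d).
Hypothesis (dp : stable (@Lplus _ _ _ _ E) d) (dm : stable (@Lminus _ _ _ _ E) d).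
Let P := plus_part d.
Let N := minus_part d.

Lemma Der0_in_plus m : d (in_plus m) = in_plus (P m).
Proof. by rewrite /P /=; have [|m' ->] := dp (u := in_plus m); first by exists m. Qed.
Lemma Der0_in_minus m : d (in_minus m) = in_minus (N m).
Proof. by rewrite /N /=; have [|m' ->] := dm (u := in_minus m); first by exists m. Qed.

Lemma hom_plus_part : hom i P.
Proof.
apply/Endo_homP => j m hm.
by have [_ ? _ _] := hom_L (Endo_hom_app dd.1 (hom_in_plus E hm)).
Qed.
Lemma hom_minus_part : hom i N.
Proof.
apply/Endo_homP => j m hm.
by have [_ _ ? _] := hom_L (Endo_hom_app dd.1 (hom_in_minus E hm)).
Qed.

Lemma Der0_decomp u : d u = d (in_zero (La u) (Lx u)) + in_plus (P (Lm u)) + in_minus (N (Ln u)).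
Proof. by rewrite {1}(L_decomp u) !EndoD Der0_in_plus Der0_in_minus. Qed.

(** Read off from the derivation rule for the product of u in L_0 and m in L_+. *)
Lemma Der0_act_p u : act_p (d u) = scomm P (act_p u).
Proof.
elim/hom_ind: u => [u v Pu Pv|j u hu].
  by rewrite EndoD !act_pD Pu Pv [RHS](scomm_biadd _).2.
rewrite Der0_decomp !act_pD act_p_in_plus act_p_in_minus !addr0; set u0 := in_zero _ _.
have hu0 : hom j u0 := hom_in_zero hu.
have [m0 n0] : Lm (d u0) = 0 /\ Ln (d u0) = 0.
  by apply/LzeroP; apply: dz; apply/LzeroP.
apply: Endo_eq; elim/hom_ind => [m m' Pm Pm'|k m hm]; first by rewrite !EndoD Pm Pm'.
have := congr1 (@Lm _ _ _ _ E) (dd.2 _ _ (in_plus m) hu0).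
rewrite (br_in_plus half annM hu0 hm) // !Der0_in_plus.
rewrite (br_in_plus half annM hu0 (Endo_hom_app hom_plus_part hm)) //.
rewrite (br_in_plus half annM (Endo_hom_app dd.1 hu0) hm) // LmD Lm_sg.
rewrite (scommE _ hom_plus_part (hom_act_p hu)) => e.
have {}e : P (act_p u m) = act_p (d u0) m + sg (i && j) (act_p u (P m)) := e.
by rewrite e addrK.
Qed.

Lemma Der0_act_m u : act_m (d u) = scomm N (act_m u).
Proof.
elim/hom_ind: u => [u v Pu Pv|j u hu].
  by rewrite EndoD !act_mD Pu Pv [RHS](scomm_biadd _).2.
rewrite Der0_decomp !act_mD act_m_in_plus act_m_in_minus !addr0; set u0 := in_zero _ _.
have hu0 : hom j u0 := hom_in_zero hu.
have [m0 n0] : Lm (d u0) = 0 /\ Ln (d u0) = 0.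
  by apply/LzeroP; apply: dz; apply/LzeroP.
apply: Endo_eq; elim/hom_ind => [m m' Pm Pm'|k m hm]; first by rewrite !EndoD Pm Pm'.
have := congr1 (@Ln _ _ _ _ E) (dd.2 _ _ (in_minus m) hu0).
rewrite (br_in_minus half annM hu0 hm) // !Der0_in_minus.
rewrite (br_in_minus half annM hu0 (Endo_hom_app hom_minus_part hm)) //.
rewrite (br_in_minus half annM (Endo_hom_app dd.1 hu0) hm) // LnD Ln_sg.
rewrite (scommE _ hom_minus_part (hom_act_m hu)) => e.
have {}e : N (act_m u m) = act_m (d u0) m + sg (i && j) (act_m u (N m)) := e.
by rewrite e addrK.
Qed.

Lemma Der0_Lm u : Lm (d u) = P (Lm u).
Proof.
rewrite Der0_decomp !LmD.
have [-> _] : Lm (d (in_zero (La u) (Lx u))) = 0 /\ Ln (d (in_zero (La u) (Lx u))) = 0.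
  by apply/LzeroP; apply: dz; apply/LzeroP.
by rewrite /= add0r addr0.
Qed.

Lemma Der0_Ln u : Ln (d u) = N (Ln u).
Proof.
rewrite Der0_decomp !LnD.
have [_ ->] : Lm (d (in_zero (La u) (Lx u))) = 0 /\ Ln (d (in_zero (La u) (Lx u))) = 0.
  by apply/LzeroP; apply: dz; apply/LzeroP.
by rewrite /= !add0r.
Qed.

(** The derivation rule for the product of m in L_+ and n in L_-, split into its
    components in A and E. *)
Lemma Der0_q_Emn S T j k (m n : V) : is_dST S T d -> P = S + T -> N = S - T ->
  hom j m -> hom k n ->
  scomm S ((q m n)%:I) + scomm T (Emn q m n) =
    (q ((S + T) m) n + sg (i && j) (q m ((S - T) n)))%:I
  /\ scomm T ((q m n)%:I) + scomm S (Emn q m n) =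
    Emn q ((S + T) m) n + sg (i && j) (Emn q m ((S - T) n)).
Proof.
move=> dST PE NE hm hn; have [ea _ _ ex] := dST (q m n) 0 0 (toE (Emn_in E m n)).
move: ea ex; rewrite -[mkL _ _ _ _]/(in_zero _ _) -br_in_plus_in_minus.
rewrite (dd.2 _ _ _ (hom_in_plus E hm)) Der0_in_plus Der0_in_minus !br_in_plus_in_minus.
rewrite PE NE => <- <-; split.
  by rewrite /La /=; case: (i && j).
by rewrite /Lx /=; case: (i && j).
Qed.

(** S and T are half the sum and half the difference of the restrictions P and N.
    The conditions on A Id and E say that d maps L_0 into itself; those on
    q(m,n) follow by comparing the products [m, n] and [n, m]. *)
Lemma Der0_hom_dST : exists S T, [/\ hom_S E S, hom_T E T & is_dST S T d].
Proof.
have [h h0 h2] := even_half half.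
pose S := h *: (P + N); pose T := h *: (P - N).
have h2E (X : Endo V) : h *: (X + X) = X by rewrite scalerDr -scalerDl h2 scale1r.
have PE : P = S + T.
  rewrite /S /T -scalerDr -[LHS]h2E; congr (_ *: _); zmod.
have NE : N = S - T.
  rewrite /S /T -scalerBr -[LHS]h2E; congr (_ *: _); zmod.
have hS : hom i S.
  rewrite -[i]addFb; apply: grZ => //.
  by apply: homD; [apply: hom_plus_part|apply: hom_minus_part].
have hT : hom i T.
  rewrite -[i]addFb; apply: grZ => //.
  by apply: homD; [apply: hom_plus_part|apply/homN; apply: hom_minus_part].
have dST : is_dST S T d.
  apply/(is_dSTP half) => u; rewrite -PE -NE.
  by split; [apply: Der0_act_p|apply: Der0_act_m|apply: Der0_Lm|apply: Der0_Ln].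
have s0 x : scomm x (0 : Endo V) = 0 by apply: (biadd0r (@scomm_biadd _ _)).
have hSx := Endo_hom_app hS; have hTx := Endo_hom_app hT.
have qNr x y : q x (- y) = sg true (q x y).
  exact: (sg_morph true _ ((qf_biadd q).2 x)).
have ENr x y : Emn q x (- y) = sg true (Emn q x y).
  exact: (sg_morph true _ ((Emn_biadd q).2 x)).
have scomm_sgr b (x y : Endo V) : scomm x (sg b y) = sg b (scomm x y).
  exact: (sg_morph _ _ ((@scomm_biadd K V).2 x)).
exists S, T; split=> //; (split; first by exists i); split.
- move=> a; have [ea _ _ _] := dST a 0 0 0; exists (La (d (mkL a 0 0 0))).
  by rewrite ea /= s0 addr0.
- move=> j k m n hm hn; apply: (dbl_inj half).
  have [e _] := Der0_q_Emn dST PE NE hm hn.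
  have [f _] := Der0_q_Emn dST PE NE hn hm.
  (* The terms with E_{m,n} cancel, as it is skew-symmetric and q symmetric. *)
  transitivity (scomm S ((q m n)%:I) + scomm T (Emn q m n)
    + sg (j && k) (scomm S ((q n m)%:I) + scomm T (Emn q n m))).
    rewrite (qf_sym q hn hm) (Emn_sym q hn hm) aId_sg scommNr !scomm_sgr; zmod.
  rewrite e f !Endo_addE !Endo_oppE !(qf_biadd q).1 !(qf_biadd q).2 !qNr.
  rewrite (qf_sym q hm (hSx _ _ hn)) (qf_sym q hm (hTx _ _ hn)).
  rewrite (qf_sym q hn (hSx _ _ hm)) (qf_sym q hn (hTx _ _ hm)).
  rewrite !(aIdD, aId_sg); zmod.
- move=> x Ex; have [_ _ _ ex] := dST 0 0 0 (toE Ex).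
  have := ospS_valP (Lx (d (mkL 0 0 0 (toE Ex)))).
  by rewrite ex aId0 s0 add0r.
- move=> a; have [_ _ _ ex] := dST a 0 0 0.
  have := ospS_valP (Lx (d (mkL a 0 0 0))).
  by rewrite ex s0 addr0.
- move=> j k m n hm hn; apply: (dbl_inj half).
  have [_ e] := Der0_q_Emn dST PE NE hm hn.
  have [_ f] := Der0_q_Emn dST PE NE hn hm.
  (* As above: now [S, E_{m,n}] cancels and [T, q(m,n)] is doubled. *)
  transitivity (scomm T ((q m n)%:I) + scomm S (Emn q m n)
    + sg (j && k) (scomm T ((q n m)%:I) + scomm S (Emn q n m))).
    rewrite (qf_sym q hn hm) (Emn_sym q hn hm) aId_sg scommNr !scomm_sgr; zmod.
  rewrite e f !Endo_addE !Endo_oppE !(Emn_biadd q).1 !(Emn_biadd q).2 !ENr.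
  rewrite (Emn_sym q hm (hSx _ _ hn)) (Emn_sym q hm (hTx _ _ hn)).
  rewrite (Emn_sym q hn (hSx _ _ hm)) (Emn_sym q hn (hTx _ _ hm)); zmod.
- move=> x Ex; have [ea _ _ _] := dST 0 0 0 (toE Ex).
  by exists (La (d (mkL 0 0 0 (toE Ex)))); rewrite ea aId0 s0 add0r.
Qed.
End HomDer0.

Lemma Der0_DM : Der0 E `<=` DM E.
Proof.
have [_ G] := Der0_gsubmod E half annM.
move=> d Dd.
have H i : exists S T, [/\ hom_S E S, hom_T E T & is_dST S T (gr i d)].
  have [_ zi pi mi] := G i d Dd; have [Dd' _ _ _] := Dd.
  exact: (Der0_hom_dST (Der_gr half annM i Dd') zi pi mi).
have [S [T [hS hT dP]]] := H false; have [S' [T' [hS' hT' dP']]] := H true.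
exists (S + S'), (T + T').
have [[_ sD _] _] := SE_gsubmod E; have [[_ tD _] _] := TE_gsubmod E.
have s1 : SE E (S + S') by apply: sD; apply: kspan_sub.
have t1 : TE E (T + T') by apply: tD; apply: kspan_sub.
split=> //; symmetry; apply: dST_eq => //.
by rewrite -(gr_sum d); apply: is_dSTD.
Qed.

Lemma DM_eq_Der0 : DM E = Der0 E.
Proof.
by apply/seteqP; split; [apply: DM_Der0|apply: Der0_DM].
Qed.

End GradedDerivations.

(** * The derivation algebra of L *)

Section AllDerivations.
Variables (K : scRingType) (A : superextType K) (M : supermodType A).
Variables (q : quadform M) (E : ospSubalg q).
Hypothesis half : exists h : K, h *+ 2 = 1.
Hypothesis annM : forall a : A, (forall m : M, a *: m = 0) -> a = 0.
Local Notation V := (resK M).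
Local Notation "a %:I" := (aId M a) (at level 2, format "a %:I").
Local Notation L := (Einf E).
Local Notation br := (Lbr E).
Local Notation in_plus := (in_plus E).
Local Notation in_minus := (in_minus E).

Definition grading_elt : L := in_zero 1 0.
Local Notation zeta := grading_elt.

Lemma hom_zeta : hom false zeta.
Proof. by apply: hom_mkL; [apply: gr1|apply: hom0..]. Qed.

Lemma act_p_zeta v : act_p zeta v = v.
Proof. by rewrite /act_p addr0 /= scale1r. Qed.
Lemma act_m_zeta v : act_m zeta v = - v.
Proof. by rewrite /act_m addr0 /= scale1r. Qed.

(** The 3-grading of L is the eigenspace decomposition of ad(zeta). *)
Lemma br_zeta i (u : L) : hom i u ->
  [/\ act_p (br zeta u) = 0, act_m (br zeta u) = 0, Lm (br zeta u) = Lm u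
    & Ln (br zeta u) = - Ln u].
Proof.
move=> hu; have hz := hom_zeta.
have sl := biadd0l (@scomm_biadd K V).
split.
- by rewrite (act_p_br hz hu) brP0 (scomm_act_p hz hu) sl.
- by rewrite (act_m_br hz hu) brP0 (scomm_act_m hz hu) sl.
- by rewrite (Lm_br hz hu) brM0 act_p_zeta.
- by rewrite (Ln_br hz hu) brM0 act_m_zeta.
Qed.

Lemma dbl_eq0 (v : V) : v = - v -> v = 0.
Proof.
move=> e; apply: (dbl_inj half); rewrite addr0 {2}e; exact: subrr.
Qed.

Lemma hom_stable (N : set L) (d : Endo L) : is_gsubmod N ->
  (forall j u, hom j u -> N u -> N (d u)) -> stable N d.
Proof.
move=> [[_ ND _] NG] H u Nu; rewrite -(gr_sum u) EndoD.
by apply: ND; (apply: H; [exact: hom_gr|exact: NG]).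
Qed.

(** For u in L_sigma, applying d to [zeta, u] = sigma u shows that
    sigma d(u) - [zeta, d(u)] = [d(zeta), u], which lies in L_sigma.  So sigma - tau
    annihilates the component of d(u) in L_tau, and it is invertible unless
    tau = sigma. *)
Lemma Der0_of_grading i (d : Endo L) :
  der_of i d -> Lzero (d zeta) -> Der0 E d.
Proof.
move=> dd /LzeroP[cm cn]; have hz := hom_zeta; set c := d zeta in cm cn.
have hc : hom i c by rewrite -[i]addbF; apply: (Endo_hom_app dd.1 hz).
have dz u : d (br zeta u) = br c u + br zeta (d u).
  by rewrite (dd.2 _ _ _ hz) andbF.
have hdu j u : hom j u -> hom (i (+) j) (d u) by apply: Endo_hom_app dd.1.
split; first exact: der_of_Der dd.
- apply: hom_stable; first exact: Lzero_gsubmod.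
  move=> j u hu /LzeroP[um un]; apply/LzeroP.
  have bz : br zeta u = 0.
    have [e1 e2 e3 e4] := br_zeta hu.
    by apply: (L_eq_coord half annM); rewrite ?e1 ?e2 ?e3 ?e4 ?act_p0 ?act_m0 // ?um ?un ?oppr0.
  have [_ _ f3 f4] := br_zeta (hdu _ _ hu).
  have := dz u; rewrite bz Endo0 => e; split.
    have := congr1 (@Lm _ _ _ _ E) e.
    by rewrite LmD f3 (Lm_br hc hu) cm /brM um !Endo0 sg0 subr0 add0r.
  have := congr1 (@Ln _ _ _ _ E) e.
  rewrite LnD f4 (Ln_br hc hu) cn /brM un !Endo0 sg0 subr0 add0r => /esym/eqP.
  by rewrite oppr_eq0 => /eqP.
- apply: hom_stable; first exact: Lplus_gsubmod.
  move=> j u hu [m e]; move: hu; rewrite {u}e -[mkL _ _ _ _]/(in_plus m) => hu.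
  have [_ hm _ _] := hom_L hu.
  have bz : br zeta (in_plus m) = in_plus m by rewrite (br_in_plus half annM hz hm) // act_p_zeta.
  have [f1 f2 f3 f4] := br_zeta (hdu _ _ hu).
  have := dz (in_plus m); rewrite bz (br_in_plus half annM hc hm cm cn) => e.
  apply/(LplusP half annM); split.
  + by rewrite e act_pD f1 act_p_in_plus addr0.
  + by rewrite e act_mD f2 act_m_in_plus addr0.
  + by apply: dbl_eq0; rewrite {1}e LnD f4 /= add0r.
- apply: hom_stable; first exact: Lminus_gsubmod.
  move=> j u hu [m e]; move: hu; rewrite {u}e -[mkL _ _ _ _]/(in_minus m) => hu.
  have [_ _ hm _] := hom_L hu.
  have bz : br zeta (in_minus m) = - in_minus m.
    rewrite (br_in_minus half annM hz hm) // act_m_zeta.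
    by apply: EinfP; rewrite /La /Lm /Ln /Lx /= ?oppr0.
  have [f1 f2 f3 f4] := br_zeta (hdu _ _ hu).
  have := dz (in_minus m); rewrite bz (br_in_minus half annM hc hm cm cn) EndoN => e.
  have {}e : d (in_minus m) = - (in_minus (act_m c m) + br zeta (d (in_minus m))) by rewrite -e opprK.
  apply/(LminusP half annM); split.
  + by rewrite e -[- _]/(sg true _) act_p_sg act_pD f1 act_p_in_minus addr0 sg0.
  + by rewrite e -[- _]/(sg true _) act_m_sg act_mD f2 act_m_in_minus addr0 sg0.
  + apply: dbl_eq0; rewrite {1}e -[- (_ + _)]/(sg true _) Lm_sg LmD f3 /= add0r //.
Qed.

Lemma br_zeta_r (u : L) : Lm (br u zeta) = - Lm u /\ Ln (br u zeta) = Ln u.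
Proof.
split.
  rewrite -[LHS](_ : La u *: (0 : M) + Lx u (0 : V) - Lm u *r 1 - sapp (Lm u) 0 = _) //.
  by rewrite scaler0 (Endo0 (Lx u)) rscale1 (biadd0r (@sapp_biadd _ _ _)); zmod.
rewrite -[LHS](_ : - (La u *: (0 : M)) + Lx u (0 : V) + Ln u *r 1 - sapp (Ln u) 0 = _) //.
by rewrite scaler0 (Endo0 (Lx u)) rscale1 (biadd0r (@sapp_biadd _ _ _)); zmod.
Qed.

(** For homogeneous d with d(zeta) = (a, m, n, x), the derivation
    d - ad(0, -m, n, 0) maps zeta into L_0. *)
Lemma Der_decomp : Der br = setsum (adL E) (DM E).
Proof.
have [[_ DD _] _] := Der_gsubmod E; have [[_ D0D _] _] := Der0_gsubmod E half annM.
have [[_ aD _] _] := adL_gsubmod E half annM.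
rewrite (DM_eq_Der0 E half annM); apply/seteqP; split=> d; last first.
  move=> [x [y [ax [Dy _ _ _] ->]]]; apply: DD => //.
  exact: (adL_Der half annM ax).
move=> Dd; have H i : setsum (adL E) (Der0 E) (gr i d).
  have dd := Der_gr half annM i Dd.
  (* [v, zeta] has the same components in L_+ and L_- as the value at zeta. *)
  pose v : L := mkL 0 (- Lm (gr i d zeta)) (Ln (gr i d zeta)) 0.
  have hdz : hom i (gr i d zeta).
    by rewrite -[i in hom i _]addbF; apply: Endo_hom_app (hom_gr _ _) hom_zeta.
  have [_ hm hn _] := hom_L hdz.
  have hv : hom i v by apply: hom_mkL; [apply: hom0|apply: homN|..|apply: hom0].
  have dv := der_of_ad half annM hv.
  exists (ad v), (gr i d - ad v); split; [by exists v| |by rewrite addrC subrK].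
  apply: (Der0_of_grading (i := i)).
    apply: der_ofD => //; rewrite -scaleN1r -[i]addFb; apply: der_ofZ => //.
    by apply: homN; apply: gr1.
  apply/LzeroP; have [zm zn] := br_zeta_r v.
  rewrite Endo_addE Endo_oppE -[- _]/(sg true _) LmD LnD Lm_sg Ln_sg.
  rewrite [ad v zeta]/(br v zeta) zm zn [Lm v]/(- Lm (gr i d zeta)).
  by rewrite [Ln v]/(Ln (gr i d zeta)); split; rewrite /= ?opprK; apply: subrr.
have [x [y [ax Dy e]]] := H false; have [x' [y' [ax' Dy' e']]] := H true.
exists (x + x'), (y + y'); split; [exact: aD|exact: D0D|].
by rewrite -(gr_sum d) e e' addrACA.
Qed.

Lemma E_SE x : ospS E x -> SE E x.
Proof.
move=> Ex; have [_ EG] := ospS_submod E; have [[_ sD _] _] := SE_gsubmod E.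
by apply: gr_ind => // i; apply: kspan_sub; apply: (E_hom_S (hom_gr i x)); apply: EG.
Qed.

Lemma aId_TE a : TE E (a%:I).
Proof.
have [[_ tD _] _] := TE_gsubmod E.
apply: gr_ind => // i; rewrite gr_aId; apply: kspan_sub.
exact: (aId_hom_T E (hom_gr i a)).
Qed.

(** The coordinates of the product with u in L_0 are the formulas for d_{x,a}. *)
Lemma ad_is_dST (u : L) : Lzero u -> is_dST (Lx u) ((La u)%:I) (ad u).
Proof.
have [_ ZG] := Lzero_gsubmod E.
move=> Zu; rewrite -[X in is_dST _ _ (ad X)](gr_sum u) adD.
have -> : (Lx u : Endo V) = (Lx (gr false u) : Endo V) + Lx (gr true u).
  by rewrite -[LHS](gr_sum (Lx u : Endo V)).
rewrite -[X in X%:I](gr_sum (La u)) aIdD.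
have H i : is_dST (Lx (gr i u)) ((La (gr i u))%:I) (ad (gr i u)).
  have [um un] := (LzeroP _).1 (ZG i u Zu); have hu := hom_gr i u.
  apply: (is_dST_on_hom half) => j v hv.
  rewrite [ad _ v]/(br _ v) (act_p_br hu hv) (act_m_br hu hv) (Lm_br hu hv) (Ln_br hu hv).
  rewrite um un !brP0 !brM0.
  have -> : (Lx (gr i u) : Endo V) + (La (gr i u))%:I = act_p (gr i u) by rewrite addrC.
  by have -> : (Lx (gr i u) : Endo V) - (La (gr i u))%:I = act_m (gr i u) by rewrite addrC.
exact: (is_dSTD half (H false) (H true)).
Qed.

Lemma dST_inner S a (ES : ospS E S) : dST E S (a%:I) = ad (in_zero a (toE ES)).
Proof.
apply: (dST_eq annM); [exact: E_SE|exact: aId_TE|].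
by apply: (ad_is_dST (u := in_zero a (toE ES))); apply/LzeroP.
Qed.

Lemma inner_eq_adLzero : DST E (SE E `&` ospS E) (TE E `&` AId M) = adLzero E.
Proof.
apply/seteqP; split=> d.
  move=> [S [T [[_ ES] [_ [a ->]] ->]]]; exists (in_zero a (toE ES)).
    by apply/LzeroP.
  exact: dST_inner.
move=> [u [a [x ->]] ->]; exists x, (a%:I); split.
- by split; [apply: E_SE|]; apply: ospS_valP.
- by split; [apply: aId_TE|exists a].
- rewrite (dST_inner a (ospS_valP x)); congr ad; exact: EinfP.
Qed.

(** If ad(u) preserves L_0 then [u, zeta] = (0, -m, n, 0) lies in L_0, which
    forces m = n = 0. *)
Lemma adL_DM : adL E `&` DM E = adLzero E.
Proof.
apply/seteqP; split=> d.
  rewrite (DM_eq_Der0 E half annM) => -[[u ->] [_ sz _ _]]; exists u => //.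
  have /sz/LzeroP : Lzero zeta by apply/LzeroP.
  rewrite [ad u zeta]/(br u zeta); have [-> ->] := br_zeta_r u => -[e1 e2].
  by apply/LzeroP; split=> //; rewrite -[Lm u]opprK e1 oppr0.
move=> dz; split; first by have [u _ ->] := dz; exists u.
by rewrite -inner_eq_adLzero in dz; have [S [T [[hS _] [hT _] ->]]] := dz; exists S, T.
Qed.

Lemma plus_partD (f g : Endo L) : plus_part (f + g) = plus_part f + plus_part g.
Proof. by apply: Endo_eq => m; rewrite [RHS]Endo_addE; apply: LmD. Qed.
Lemma minus_partD (f g : Endo L) :
  minus_part (f + g) = minus_part f + minus_part g.
Proof. by apply: Endo_eq => m; rewrite [RHS]Endo_addE; apply: LnD. Qed.

(** Restriction to a stable submodule respects commutators. *)
Lemma plus_part_scomm (f g : Endo L) : Der0 E f -> Der0 E g ->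
  plus_part (scomm f g) = scomm (plus_part f) (plus_part g).
Proof.
have [_ G] := Der0_gsubmod E half annM => Df Dg.
have H i j : plus_part (scomm (gr i f) (gr j g)) =
    scomm (plus_part (gr i f)) (plus_part (gr j g)).
  have [Df' _ _ _] := Df; have [Dg' _ _ _] := Dg.
  have [_ _ pf _] := G i f Df; have [_ _ pg _] := G j g Dg.
  have hf := hom_plus_part (Der_gr half annM i Df'); have hg := hom_plus_part (Der_gr half annM j Dg').
  apply: Endo_eq => m; rewrite (scommE m hf hg).
  rewrite -[LHS]/(Lm (scomm (gr i f) (gr j g) (in_plus m))).
  rewrite (scommE _ (hom_gr i f) (hom_gr j g)) (Der0_in_plus pf m) (Der0_in_plus pg m).
  by rewrite (Der0_in_plus pf) (Der0_in_plus pg) -[- _]/(sg true _) LmD !Lm_sg.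
rewrite -{1}(gr_sum f) -{1}(gr_sum g) (scomm_biadd _).1 !(scomm_biadd _).2.
rewrite plus_partD (plus_partD (scomm (gr false f) _)).
rewrite (plus_partD (scomm (gr true f) _)) !H.
by rewrite -!(scomm_biadd _).2 -(scomm_biadd _).1 -!plus_partD !gr_sum.
Qed.

Lemma minus_part_scomm (f g : Endo L) : Der0 E f -> Der0 E g ->
  minus_part (scomm f g) = scomm (minus_part f) (minus_part g).
Proof.
have [_ G] := Der0_gsubmod E half annM => Df Dg.
have H i j : minus_part (scomm (gr i f) (gr j g)) =
    scomm (minus_part (gr i f)) (minus_part (gr j g)).
  have [Df' _ _ _] := Df; have [Dg' _ _ _] := Dg.
  have [_ _ _ pf] := G i f Df; have [_ _ _ pg] := G j g Dg.
  have hf := hom_minus_part (Der_gr half annM i Df'); have hg := hom_minus_part (Der_gr half annM j Dg').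
  apply: Endo_eq => m; rewrite (scommE m hf hg).
  rewrite -[LHS]/(Ln (scomm (gr i f) (gr j g) (in_minus m))).
  rewrite (scommE _ (hom_gr i f) (hom_gr j g)) (Der0_in_minus pf m) (Der0_in_minus pg m).
  by rewrite (Der0_in_minus pf) (Der0_in_minus pg) -[- _]/(sg true _) LnD !Ln_sg.
rewrite -{1}(gr_sum f) -{1}(gr_sum g) (scomm_biadd _).1 !(scomm_biadd _).2.
rewrite minus_partD (minus_partD (scomm (gr false f) _)).
rewrite (minus_partD (scomm (gr true f) _)) !H.
by rewrite -!(scomm_biadd _).2 -(scomm_biadd _).1 -!minus_partD !gr_sum.
Qed.

Lemma dST_parts S T (d : Endo L) : is_dST S T d ->
  plus_part d = S + T /\ minus_part d = S - T.
Proof.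
move=> /(is_dSTP half) dP; split; apply: Endo_eq => m.
  by have [_ _ e _] := dP (in_plus m).
by have [_ _ _ e] := dP (in_minus m).
Qed.

(** The commutator of two such maps lies in (Der L)_0, so it is d_{S2,T2} for
    some S2 and T2; comparing restrictions to L_+ and L_- determines them.
    So the brackets inherit the defining conditions from S2 and T2. *)
Lemma dST_scomm S T S' T' : SE E S -> TE E T -> SE E S' -> TE E T' ->
  [/\ SE E (scomm S S' + scomm T T'), TE E (scomm S T' + scomm T S')
    & dST E (scomm S S' + scomm T T') (scomm S T' + scomm T S') =
      scomm (dST E S T) (dST E S' T')].
Proof.
move=> hS hT hS' hT'; have DMD := DM_eq_Der0 E half annM.
have d1 : Der0 E (dST E S T) by rewrite -DMD; exists S, T.
have d2 : Der0 E (dST E S' T') by rewrite -DMD; exists S', T'.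
have [S2 [T2 [h1 h2 e]]] : DM E (scomm (dST E S T) (dST E S' T')).
  by rewrite DMD; apply: Der0_scomm.
have [p1 m1] := dST_parts (dSTP annM hS hT).
have [p2 m2] := dST_parts (dSTP annM hS' hT').
have [p3 m3] := dST_parts (dSTP annM h1 h2).
have eP := plus_part_scomm d1 d2; have eM := minus_part_scomm d1 d2.
rewrite e p1 p2 p3 in eP; rewrite e m1 m2 m3 in eM.
have eS : S2 = scomm S S' + scomm T T'.
  apply: (dbl_inj half).
  have -> : S2 + S2 = (S2 + T2) + (S2 - T2) by zmod.
  rewrite eP eM !((scomm_biadd _).1, (scomm_biadd _).2, scommNl, scommNr); zmod.
have eT : T2 = scomm S T' + scomm T S'.
  apply: (dbl_inj half).
  have -> : T2 + T2 = (S2 + T2) - (S2 - T2) by zmod.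
  rewrite eP eM !((scomm_biadd _).1, (scomm_biadd _).2, scommNl, scommNr); zmod.
by rewrite -eS -eT.
Qed.

Lemma dST_0 : dST E 0 0 = 0.
Proof.
have [[s0 _ _] _] := SE_gsubmod E; have [[t0 _ _] _] := TE_gsubmod E.
by have := dST_Z half annM 0 s0 t0; rewrite !scaler0 scale0r.
Qed.

Lemma DST_gsubmod X Y : X `<=` SE E -> Y `<=` TE E -> is_gsubmod X ->
  is_gsubmod Y -> is_gsubmod (DST E X Y).
Proof.
move=> XS YT [[X0 XD XZ] XG] [[Y0 YD YZ] YG]; split; first split.
- by exists 0, 0; split=> //; rewrite dST_0.
- move=> _ _ [S [T [hS hT ->]]] [S' [T' [hS' hT' ->]]].
  exists (S + S'), (T + T'); split; [exact: XD|exact: YD|].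
  by rewrite dST_D //; [apply: XS|apply: YT|apply: XS|apply: YT].
- move=> k _ [S [T [hS hT ->]]]; exists (k *: S), (k *: T).
  split; [exact: XZ|exact: YZ|].
  by rewrite dST_Z //; [apply: XS|apply: YT].
- move=> i _ [S [T [hS hT ->]]]; exists (gr i S), (gr i T).
  split; [exact: XG|exact: YG|].
  by rewrite dST_gr //; [apply: XS|apply: YT].
Qed.

Lemma dST_inj S T S' T' : SE E S -> TE E T -> SE E S' -> TE E T' ->
  dST E S T = dST E S' T' -> S = S' /\ T = T'.
Proof.
move=> hS hT hS' hT' e; apply: (is_dST_inj half (dSTP annM hS hT)).
by rewrite e; apply: (dSTP annM).
Qed.

Lemma prod_gsubmod (U W : supermodType K) (X : set U) (Y : set W) :
  is_gsubmod X -> is_gsubmod Y -> is_gsubmod (X `*` Y).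
Proof.
move=> [[X0 XD XZ] XG] [[Y0 YD YZ] YG]; split; first split.
- by split.
- by move=> [a b] [c d] [/= ? ?] [/= ? ?]; split; [apply: XD|apply: YD].
- by move=> k [a b] [/= ? ?]; split; [apply: XZ|apply: YZ].
- by move=> i [a b] [/= ? ?]; split; [apply: XG|apply: YG].
Qed.

(** The right action of k on v is a signed sum of left multiples of the
    homogeneous components of v. *)
Lemma gsubmod_rscale_morph (U W : supermodType K) (X : set U) (f : U -> W) :
  is_gsubmod X ->
  (forall u v, X u -> X v -> f (u + v) = f u + f v) ->
  (forall (k : K) u, X u -> f (k *: u) = k *: f u) ->
  (forall i u, X u -> f (gr i u) = gr i (f u)) ->
  forall u (k : K), X u -> f (u *r k) = f u *r k.
Proof.
move=> gX fD fZ fG u k Xu; have [[X0 XD XZ] XG] := gX.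
have fsg b v : X v -> f (sg b v) = sg b (f v).
  by move=> Xv; case: b => //=; rewrite -!scaleN1r fZ.
rewrite /rscale /koszul !big_bool /=.
have Xt i j : X (gr i k *: gr j u) by apply/XZ/XG.
have Xn i j : X (- (gr i k *: gr j u)) by apply: (submod_sg gX true).
rewrite !fD ?(fsg true) ?fZ ?fG //; try exact: XG.
all: by apply: XD.
Qed.

Lemma STbr_subalg : is_subalg (@STbr K A M) setT (SE E `*` TE E).
Proof.
split=> //.
  by apply: prod_gsubmod; [apply: SE_gsubmod|apply: TE_gsubmod].
move=> [S T] [S' T'] [/= hS hT] [/= hS' hT'].
by have [] := dST_scomm hS hT hS' hT'.
Qed.

Lemma DM_subalg : is_subalg (@scomm K L) (Der br) (DM E).
Proof.
rewrite (DM_eq_Der0 E half annM); split=> [d []//||d d'].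
- exact: Der0_gsubmod.
- exact: Der0_scomm.
Qed.

Lemma dST_lie_iso : is_lie_iso (@STbr K A M) (@scomm K L)
  (SE E `*` TE E) (DM E) (fun u => dST E u.1 u.2).
Proof.
have [_ gX _] := STbr_subalg; have [_ gD sD] := DM_subalg.
split; [exact: STbr_subalg|by split| |].
- split.
  + by move=> [S T] [/= hS hT]; exists S, T.
  + move=> [S T] [S' T']; rewrite !inE => -[/= hS hT] [/= hS' hT'] e.
    by have [-> ->] := dST_inj hS hT hS' hT' e.
  + by move=> _ [S [T [hS hT ->]]]; exists (S, T).
- have fD u v : (SE E `*` TE E) u -> (SE E `*` TE E) v ->
      dST E (u + v).1 (u + v).2 = dST E u.1 u.2 + dST E v.1 v.2.
    by move=> [hS hT] [hS' hT']; apply: dST_D.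
  have fG i u : (SE E `*` TE E) u ->
      dST E (gr i u).1 (gr i u).2 = gr i (dST E u.1 u.2).
    by move=> [hS hT]; apply: dST_gr.
  split=> //.
  + move=> u k Xu.
    apply: (gsubmod_rscale_morph (f := fun u => dST E u.1 u.2) gX) => //.
    by move=> l v [hS hT]; apply: dST_Z.
  + by move=> i v Xv hv; rewrite /hom -fG // hv.
  + move=> [S T] [S' T'] [/= hS hT] [/= hS' hT'].
    by have [] := dST_scomm hS hT hS' hT'.
Qed.

(** An element d_{S,T} of both summands has S in S_0 and in E, and T in T_0 and
    in A Id, by [adL_DM] and the injectivity of (S, T) |-> d_{S,T}. *)
Lemma Der_semidirect (S0 T0 : set (Endo V)) :
  is_dsum (SE E) (ospS E) S0 -> is_dsum (TE E) (AId M) T0 ->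
  is_subalg (@STbr K A M) (SE E `*` TE E) (S0 `*` T0) ->
  is_semidirect (@scomm K L) (Der br) (adL E) (DST E S0 T0).
Proof.
move=> [gE gS0 SEe ES0] [gA gT0 TEe AT0] [_ _ ST0].
have S0S : S0 `<=` SE E.
  by have [[e0 _ _] _] := gE; move=> S hS; rewrite SEe; exists 0, S; rewrite add0r.
have T0T : T0 `<=` TE E.
  by have [[a0 _ _] _] := gA; move=> T hT; rewrite TEe; exists 0, T; rewrite add0r.
have DSTM : DST E S0 T0 `<=` DM E.
  by move=> _ [S [T [hS hT ->]]]; exists S, T; split; [apply: S0S|apply: T0T|].
have [DMDer _ _] := DM_subalg.
have gDST := DST_gsubmod S0S T0T gS0 gT0.
split; first exact: adL_ideal.
- split=> //; first by move=> d /DSTM /DMDer.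
  move=> _ _ [S [T [hS hT ->]]] [S' [T' [hS' hT' ->]]].
  have [_ _ <-] := dST_scomm (S0S _ hS) (T0T _ hT) (S0S _ hS') (T0T _ hT').
  have [/= h1 h2] : (S0 `*` T0) (STbr (S, T) (S', T')) by apply: ST0.
  by exists (scomm S S' + scomm T T'), (scomm S T' + scomm T S').
- split=> //; first exact: adL_gsubmod.
  + rewrite Der_decomp; apply/seteqP; split=> _ [x [y [ax hy ->]]]; last first.
      by exists x, y; split=> //; apply: DSTM.
    have [S [T [hS hT ->]]] := hy.
    have [S1 [S2 [ES1 hS2 eS]]] : setsum (ospS E) S0 S by rewrite -SEe.
    have [T1 [T2 [AT1 hT2 eT]]] : setsum (AId M) T0 T by rewrite -TEe.
    have [a eT1] := AT1.
    have [[_ aD _] _] := adL_gsubmod E half annM.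
    exists (x + dST E S1 T1), (dST E S2 T2); split.
    * by apply: aD => //; rewrite eT1 (dST_inner a ES1); exists (in_zero a (toE ES1)).
    * by exists S2, T2.
    * rewrite -addrA -dST_D -?eS -?eT //.
      - exact: E_SE.
      - by rewrite eT1; apply: aId_TE.
      - exact: S0S.
      - exact: T0T.
  + apply/seteqP; split=> d; last first.
      move=> ->; split; first by have [[]] := adL_gsubmod E half annM.
      by have [[]] := gDST.
    move=> [ad_d Dd]; have : (adL E `&` DM E) d by split=> //; apply: DSTM.
    rewrite adL_DM -inner_eq_adLzero => -[S [T [[hS ES] [hT AT] e]]].
    have [S' [T' [hS' hT' e']]] := Dd.
    have [eS eT] : S = S' /\ T = T'.
      by apply: dST_inj => //; [apply: S0S|apply: T0T|rewrite -e].
    have S00 : S = 0 by have : [set 0] S by rewrite -ES0; split=> //; rewrite eS.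
    have T00 : T = 0 by have : [set 0] T by rewrite -AT0; split=> //; rewrite eT.
    by rewrite e S00 T00 dST_0.
Qed.
End AllDerivations.

Theorem theorem3p11 (K : scRingType) (A : superextType K) (M : supermodType A)
    (q : quadform M) (E : ospSubalg q)
    (half : exists h : K, h *+ 2 = 1)
    (annM : forall a : A, (forall m : M, a *: m = 0) -> a = 0) :
  [/\
      [/\ DM E = Der0 E,
          is_subalg (@scomm K (Einf E)) (Der (Lbr E)) (DM E)
        & is_lie_iso (@STbr K A M) (@scomm K (Einf E))
            (SE E `*` TE E) (DM E) (fun u => dST E u.1 u.2)],
      Der (Lbr E) = setsum (adL E) (DM E),
      adL E `&` DM E = DST E (SE E `&` ospS E) (TE E `&` AId M)
        /\ DST E (SE E `&` ospS E) (TE E `&` AId M) = adLzero E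
    & forall S0 T0 : set (Endo (resK M)),
        is_dsum (SE E) (ospS E) S0 ->
        is_dsum (TE E) (AId M) T0 ->
        is_subalg (@STbr K A M) (SE E `*` TE E) (S0 `*` T0) ->
        is_semidirect (@scomm K (Einf E)) (Der (Lbr E)) (adL E) (DST E S0 T0)].
Proof.
split; first split.
- exact: DM_eq_Der0.
- exact: DM_subalg.
- exact: dST_lie_iso.
- exact: Der_decomp.
- by rewrite adL_DM // inner_eq_adLzero.
- exact: Der_semidirect.
Qed.
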